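(* Let $E=D[x,y;\sigma,\tau,b,\rho]$ be a diskew polynomial ring such that $\rho$ is a unit in $D$ and $\nu:=\tau\sigma$ is an epimorphism (a surjective endomorphism of $D$). Let $\mathcal{D}=D[h;\nu]$ where $h=yx$, with $\sigma,\tau$ extended to $\mathcal{D}$ as in the context. The following statements are equivalent. 1. The ring $E$ is a simple ring. 2. (a) The endomorphisms $\sigma$ and $\tau$ of $D$ are automorphisms; (b) the ring $D$ is a $\sigma$-simple ring; (c) for each natural number $n\ge 1$ there is no element $p=h^n+\sum_{i=0}^{n-1}d_ih^i\in\mathcal{D}$, where $d_i\in D$, such that (i) for all elements $d\in D$, $pd=\nu^n(d)p$, i.e., $d_id=\nu^{n-i}(d)d_i$ for $i=0,1,\ldots,n-1$, (ii) $\sigma(p)=\rho_n^\nu p$ where $\rho_n^\nu=\rho\,\nu(\rho)\cdots\nu^{n-1}(\rho)$, and (iii) $[h,p]=0$, i.e., $\nu(d_i)=d_i$ for $i=0,1,\ldots,n-1$; and (d) the elements $b_i\in D$, where $i\ge 1$, are units in $D$. (In particular, $b=b_1\in D$ is a unit.) 3. (a) The endomorphisms $\sigma$ and $\tau$ of $D$ are automorphisms; (b) the ring $D$ is a $\tau$-simple ring; (c) for each natural number $n\ge 1$ there is no element $p'=h'^n+\sum_{i=0}^{n-1}d_i'h'^i\in\mathcal{D}=D[h';\mu:=\sigma\tau]$, where $d_i'\in D$ and $h'=\sigma(h)$, such that (i) for all elements $d\in D$, $p'd=\mu^n(d)p'$, i.e., $d_i'd=\mu^{n-i}(d)d_i'$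 for $i=0,1,\ldots,n-1$, (ii) $\tau(p')=(\rho^{-1})_n^\mu p'$ where $(\rho^{-1})_n^\mu:=\rho^{-1}\mu(\rho^{-1})\cdots\mu^{n-1}(\rho^{-1})$, and (iii) $[h',p']=0$, i.e., $\mu(d_i')=d_i'$ for $i=0,1,\ldots,n-1$; and (d) the elements $b_i'\in D$, where $i\ge 1$, are units in $D$. (In particular, $b=b_1\in D$ is a unit.)
   Context: Diskew polynomial ring: let $D$ be a ring, $\sigma,\tau$ ring endomorphisms of $D$, and $\rho,b\in D$ such that $\sigma\tau(d)\rho=\rho\,\tau\sigma(d)$ and $\sigma\tau(d)b=bd$ for all $d\in D$. Then $E=D[x,y;\sigma,\tau,b,\rho]$ is the ring generated by $D$, $x$ and $y$ subject to the defining relations $xd=\sigma(d)x$, $yd=\tau(d)y$ for all $d\in D$, and $xy-\rho yx=b$. Products of endomorphisms are compositions. When $\rho$ is a unit, the subring $\mathcal{D}$ of $E$ generated by $D$ and $h=yx$ is the skew polynomial ring $D[h;\nu]$, $\nu=\tau\sigma$ (so $hd=\nu(d)h$ for $d\in D$). The endomorphisms $\sigma,\tau$ of $D$ extend to ring endomorphisms of $\mathcal{D}$ by $\sigma(h)=\rho h+b$ and $\tau(h)=\tau(\rho^{-1})(h-\tau(b))$. With $h':=\sigma(h)=\rho h+b=xy$ one also has $\mathcal{D}=D[h';\mu]$, $\mu=\sigma\tau$ ($h'd=\mu(d)h'$). For $i\ge1$ the elements $a_i,b_i,a_i',b_i'\in D$ are defined by $\sigma^i(h)=a_ih+b_i$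 and $\tau^i(h)=a_i'h+b_i'$; explicitly $a_i=\sigma^{i-1}(\rho)\cdots\sigma(\rho)\rho$, $b_i=\sum_{j=1}^{i-1}\sigma^j(a_{i-j})\sigma^{j-1}(b)+\sigma^{i-1}(b)$, $a_i'=\tau^i(\rho^{-1})\cdots\tau^2(\rho^{-1})\tau(\rho^{-1})$, $b_i'=-\sum_{j=1}^{i-1}\tau^j(a'_{i-j})\tau^j(\rho^{-1}b)-\tau^i(\rho^{-1}b)$. $D$ is $\sigma$-simple if $0$ and $D$ are the only ideals $I$ of $D$ with $\sigma(I)\subseteq I$ (similarly $\tau$-simple). $[s,t]=st-ts$. *)

(* Defs.v *)
From HB Require Import structures.
From mathcomp Require Import all_boot all_order all_algebra generic_quotient.
From mathcomp Require Import boolp.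

Set Implicit Arguments.
Unset Strict Implicit.
Unset Printing Implicit Defensive.

Import GRing.Theory.
Local Open Scope ring_scope.
Local Open Scope quotient_scope.

(* Ideals are two-sided. Closure under opposites follows from closure under
   multiplication by -1. *)
Definition two_sided_ideal (R : pzRingType) (I : R -> Prop) : Prop :=
  [/\ I 0,
      forall x y, I x -> I y -> I (x + y) &
      forall a x, I x -> I (a * x) /\ I (x * a)].

Definition zero_or_full (R : pzRingType) (I : R -> Prop) : Prop :=
  (forall x, I x <-> x = 0) \/ (forall x, I x).

Definition simple_ring (R : pzRingType) : Prop :=
  (1 : R) <> 0 /\
  forall I : R -> Prop, two_sided_ideal I -> zero_or_full I.

Definition endo_simple (R : pzRingType) (s : R -> R) : Prop :=
  forall I : R -> Prop,
    two_sided_ideal I -> (forall x, I x -> I (s x)) -> zero_or_full I.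

Section IterRmorphism.
Variables (R : pzRingType) (f : {rmorphism R -> R}).

Lemma iter_rmorph0 n : iter n f 0 = 0.
Proof. by elim: n => //= n ->; rewrite rmorph0. Qed.
Lemma iter_rmorph1 n : iter n f 1 = 1.
Proof. by elim: n => //= n ->; rewrite rmorph1. Qed.
Lemma iter_rmorphD n : {morph iter n f : x y / x + y}.
Proof. by move=> x y; elim: n => //= n ->; rewrite rmorphD. Qed.
Lemma iter_rmorphN n : {morph iter n f : x / - x}.
Proof. by move=> x; elim: n => //= n ->; rewrite rmorphN. Qed.
Lemma iter_rmorphM n : {morph iter n f : x y / x * y}.
Proof. by move=> x y; elim: n => //= n ->; rewrite rmorphM. Qed.
Lemma iter_rmorph_sum n (I : Type) (r : seq I) (P : pred I) (F : I -> R) :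
  iter n f (\sum_(i <- r | P i) F i) = \sum_(i <- r | P i) iter n f (F i).
Proof. by apply: big_morph; [exact: iter_rmorphD | exact: iter_rmorph0]. Qed.

End IterRmorphism.

(* The skew polynomial ring D[h; nu], with h d = nu(d) h. The element
   \sum_i d_i h^i is stored as the polynomial with coefficients d_i; only the
   additive structure of {poly D} is reused. *)
Record skewpoly (D : nzRingType) (nu : {rmorphism D -> D}) :=
  SkewPoly { skewcoef : {poly D} }.
Arguments SkewPoly {D} nu _.

Section SkewPolyRing.
Variables (D : nzRingType) (nu : {rmorphism D -> D}).

HB.instance Definition _ := [isNew for @skewcoef D nu].
HB.instance Definition _ := [Choice of skewpoly nu by <:].

Implicit Types p q r : skewpoly nu.

Lemma skewpolyP p q :
  (forall i, (skewcoef p)`_i = (skewcoef q)`_i) -> p = q.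
Proof. by case: p q => [p] [q] /= /polyP ->. Qed.

Definition skew_zero : skewpoly nu := SkewPoly nu 0.
Definition skew_add p q := SkewPoly nu (skewcoef p + skewcoef q).
Definition skew_opp p := SkewPoly nu (- skewcoef p).

Fact skew_addA : associative skew_add.
Proof. by move=> p q r; rewrite /skew_add addrA. Qed.
Fact skew_addC : commutative skew_add.
Proof. by move=> p q; rewrite /skew_add addrC. Qed.
Fact skew_add0 : left_id skew_zero skew_add.
Proof. by case=> p; rewrite /skew_add add0r. Qed.
Fact skew_addN : left_inverse skew_zero skew_opp skew_add.
Proof. by move=> p; rewrite /skew_add /= addNr. Qed.

HB.instance Definition _ := GRing.isZmodule.Build (skewpoly nu)
  skew_addA skew_addC skew_add0 skew_addN.

Definition skew_one : skewpoly nu := SkewPoly nu 1.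
Definition skew_mul p q : skewpoly nu :=
  SkewPoly nu (\poly_(k < (size (skewcoef p) + size (skewcoef q)).-1)
     \sum_(i < k.+1) (skewcoef p)`_i * iter i nu (skewcoef q)`_(k - i)).

Fact coef_skew_mul p q k :
  (skewcoef (skew_mul p q))`_k =
  \sum_(i < k.+1) (skewcoef p)`_i * iter i nu (skewcoef q)`_(k - i).
Proof.
rewrite coef_poly ltn_predRL; case: leqP => // le_pq_k1.
rewrite big1 // => j _.
have [lq_p_j|lt_j_p] := leqP (size (skewcoef p)) j.
  by rewrite nth_default ?mul0r.
rewrite [(skewcoef q)`__]nth_default ?iter_rmorph0 ?mulr0 //.
rewrite leq_subRL -ltnS //.
by rewrite (leq_trans _ le_pq_k1) // ltn_add2r.
Qed.

Fact coef_skew_mul_rev p q k :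
  (skewcoef (skew_mul p q))`_k =
  \sum_(i < k.+1) (skewcoef p)`_(k - i) * iter (k - i) nu (skewcoef q)`_i.
Proof.
rewrite coef_skew_mul (reindex_inj rev_ord_inj) /=.
by apply: eq_bigr => j _; rewrite (sub_ordK j).
Qed.

Fact skew_mulA : associative skew_mul.
Proof.
move=> p q r; apply/skewpolyP=> i; rewrite coef_skew_mul coef_skew_mul_rev.
pose coef3 j k := (skewcoef p)`_j * (iter j nu (skewcoef q)`_(i - j - k)
  * iter (i - k) nu (skewcoef r)`_k).
transitivity (\sum_(j < i.+1) \sum_(k < i.+1 | (k <= i - j)%N) coef3 j k).
  apply: eq_bigr => /= j _.
  rewrite coef_skew_mul_rev iter_rmorph_sum big_distrr /=.
  rewrite (big_ord_narrow_leq (leq_subr _ _)) /=.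
  apply: eq_bigr => k _; rewrite iter_rmorphM -iterD /coef3 /=.
  have lekij : (k <= i - j)%N by rewrite -ltnS.
  congr (_ * (_ * iter _ _ _)).
  by rewrite subnAC subnKC // leq_subRL ?(leq_trans lekij) ?leq_subr //
     addnC -leq_subRL // -ltnS.
rewrite (exchange_big_dep predT) //=; apply: eq_bigr => k _.
transitivity (\sum_(j < i.+1 | (j <= i - k)%N) coef3 j k).
  apply: eq_bigl => j; rewrite -ltnS -(ltnS j) -!subSn ?leq_ord //.
  by rewrite -subn_gt0 -(subn_gt0 j) -!subnDA addnC.
rewrite (big_ord_narrow_leq (leq_subr _ _)) coef_skew_mul big_distrl /=.
by apply: eq_bigr => j _; rewrite /coef3 -!subnDA addnC mulrA.
Qed.

Fact skew_mul1l : left_id skew_one skew_mul.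
Proof.
move=> p; apply/skewpolyP => i; rewrite coef_skew_mul big_ord_recl subn0.
by rewrite big1 => [|j _]; rewrite coef1 ?mul0r ?mul1r ?addr0.
Qed.

Fact skew_mul1r : right_id skew_one skew_mul.
Proof.
move=> p; apply/skewpolyP => i; rewrite coef_skew_mul_rev big_ord_recl subn0.
by rewrite big1 => [|j _]; rewrite coef1 /= ?iter_rmorph0 ?iter_rmorph1 ?mulr0
   ?mulr1 ?addr0.
Qed.

Fact skew_mulDl : left_distributive skew_mul +%R.
Proof.
move=> p q r; apply/skewpolyP=> i; rewrite coefD !coef_skew_mul -big_split.
by apply: eq_bigr => j _; rewrite coefD mulrDl.
Qed.

Fact skew_mulDr : right_distributive skew_mul +%R.
Proof.
move=> p q r; apply/skewpolyP=> i; rewrite coefD !coef_skew_mul -big_split.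
by apply: eq_bigr => j _; rewrite coefD iter_rmorphD mulrDr.
Qed.

Fact skew_one_neq0 : skew_one != 0.
Proof.
apply/eqP => /(congr1 (fun p => (skewcoef p)`_0)) /eqP.
by rewrite coef1 coef0 oner_eq0.
Qed.

HB.instance Definition _ := GRing.Zmodule_isNzRing.Build (skewpoly nu)
  skew_mulA skew_mul1l skew_mul1r skew_mulDl skew_mulDr skew_one_neq0.

Definition skewC (d : D) : skewpoly nu := SkewPoly nu d%:P.
Definition skewX : skewpoly nu := SkewPoly nu 'X.

Definition skewM (d : D) (i : nat) : skewpoly nu := SkewPoly nu (d *: 'X^i).

Lemma coef_skewM d i k : (skewcoef (skewM d i))`_k = d *+ (k == i).
Proof. by rewrite coefZ coefXn mulr_natr. Qed.

Lemma skewCE d : skewC d = skewM d 0.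
Proof. by congr SkewPoly; rewrite expr0 alg_polyC. Qed.

Lemma skewXE : skewX = skewM 1 1.
Proof. by congr SkewPoly; rewrite expr1 scale1r. Qed.

Lemma skewMM c d i j : skewM c i * skewM d j = skewM (c * iter i nu d) (i + j).
Proof.
apply/skewpolyP => k; rewrite coef_skew_mul coef_skewM.
have [->|ne] := eqVneq k (i + j)%N.
  have lti : (i < (i + j).+1)%N by rewrite ltnS leq_addr.
  rewrite (bigD1 (Ordinal lti)) //= !coef_skewM eqxx addKn eqxx big1 ?addr0 //.
  move=> l /eqP nl; rewrite coef_skewM; case: eqP => [E|]; last by rewrite mul0r.
  by case: nl; apply: val_inj.
apply: big1 => l _; rewrite !coef_skewM.
have [El|] := eqVneq (l : nat) i; last by rewrite mul0r.
have [Ek|] := eqVneq (k - l)%N j; last by rewrite iter_rmorph0 mulr0.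
by move: ne; rewrite -El -Ek subnKC ?eqxx // -ltnS.
Qed.

Lemma skewXn n : skewX ^+ n = skewM 1 n.
Proof.
elim: n => [|n IH]; first by congr SkewPoly; rewrite expr0 scale1r.
by rewrite exprS IH skewXE skewMM mul1r iter_rmorph1.
Qed.

Lemma skewME d i : skewM d i = skewC d * skewX ^+ i.
Proof. by rewrite skewXn skewCE skewMM mulr1. Qed.

Fact skewC_is_zmod_morphism : zmod_morphism skewC.
Proof. by move=> c d; congr SkewPoly; rewrite polyCB. Qed.

Fact skewC_is_monoid_morphism : monoid_morphism skewC.
Proof. by split=> // c d; rewrite !skewCE skewMM. Qed.

HB.instance Definition _ :=
  GRing.isZmodMorphism.Build D (skewpoly nu) skewC skewC_is_zmod_morphism.
HB.instance Definition _ :=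
  GRing.isMonoidMorphism.Build D (skewpoly nu) skewC skewC_is_monoid_morphism.

Lemma skewXC d : skewX * skewC d = skewC (nu d) * skewX.
Proof. by rewrite skewCE skewXE skewMM skewCE skewMM mul1r mulr1. Qed.

Lemma skewcoef_is_zmod_morphism : zmod_morphism (@skewcoef D nu).
Proof. by []. Qed.

HB.instance Definition _ :=
  GRing.isZmodMorphism.Build (skewpoly nu) {poly D} (@skewcoef D nu)
    skewcoef_is_zmod_morphism.

Lemma skewpolyE p :
  p = \sum_(i < size (skewcoef p)) skewC (skewcoef p)`_i * skewX ^+ i.
Proof.
apply: val_inj; rewrite /= raddf_sum -[LHS]coefK poly_def.
by apply: eq_bigr => i _; rewrite -skewME.
Qed.

End SkewPolyRing.

(* The map \sum_i d_i h^i |-> \sum_i f(d_i) u^i; a ring morphism as soon as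
   u f(d) = f(nu(d)) u. *)
Definition skew_eval (D : nzRingType) (nu : {rmorphism D -> D})
    (T : pzRingType) (f : D -> T) (u : T) (p : skewpoly nu) : T :=
  \sum_(i < size (skewcoef p)) f (skewcoef p)`_i * u ^+ i.

Section SkewEval.
Variables (D : nzRingType) (nu : {rmorphism D -> D}) (T : pzRingType).
Variables (f : {rmorphism D -> T}) (u : T).
Let ev := @skew_eval D nu T f u.

Lemma skew_eval_wide n p : (size (skewcoef p) <= n)%N ->
  ev p = \sum_(i < n) f (skewcoef p)`_i * u ^+ i.
Proof.
move=> le_pn; rewrite /ev /skew_eval.
rewrite (big_ord_widen n (fun i => f (skewcoef p)`_i * u ^+ i) le_pn).
rewrite big_mkcond; apply: eq_bigr => i _; case: ltnP => // le_pi.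
by rewrite nth_default // rmorph0 mul0r.
Qed.

Lemma skew_evalD : {morph ev : p q / p + q}.
Proof.
move=> p q; pose n := maxn (size (skewcoef p)) (size (skewcoef q)).
rewrite !(@skew_eval_wide n) ?leq_maxl ?leq_maxr ?size_polyD //.
by rewrite -big_split; apply: eq_bigr => i _; rewrite coefD rmorphD mulrDl.
Qed.

Lemma skew_eval0 : ev 0 = 0.
Proof. by rewrite /ev /skew_eval size_poly0 big_ord0. Qed.

Lemma skew_eval_sum n (F : 'I_n -> skewpoly nu) :
  ev (\sum_i F i) = \sum_i ev (F i).
Proof. by apply: big_morph; [exact: skew_evalD | exact: skew_eval0]. Qed.

Lemma skew_evalM1 d i : ev (skewM nu d i) = f d * u ^+ i.
Proof.
rewrite (@skew_eval_wide i.+1); last first.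
  by rewrite (leq_trans (size_scale_leq _ _)) ?size_polyXn.
rewrite big_ord_recr big1 /= ?add0r ?(coef_skewM nu) ?eqxx // => j _.
by rewrite /= (coef_skewM nu) ltn_eqF // rmorph0 mul0r.
Qed.

Lemma skew_evalC d : ev (skewC nu d) = f d.
Proof. by rewrite skewCE skew_evalM1 mulr1. Qed.

Lemma skew_evalX : ev (skewX nu) = u.
Proof. by rewrite skewXE skew_evalM1 rmorph1 mul1r. Qed.

Hypothesis uf : forall d, u * f d = f (nu d) * u.

Lemma skew_eval_twist n d : u ^+ n * f d = f (iter n nu d) * u ^+ n.
Proof.
elim: n => [|n IH]; first by rewrite mul1r mulr1.
by rewrite exprS -mulrA IH mulrA uf -mulrA.
Qed.

Lemma skew_evalM : {morph ev : p q / p * q}.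
Proof.
move=> p q; rewrite {1}[p]skewpolyE {1}[q]skewpolyE mulr_suml skew_eval_sum.
rewrite {2}/ev /skew_eval mulr_suml; apply: eq_bigr => i _.
rewrite mulr_sumr skew_eval_sum {2}/ev /skew_eval mulr_sumr.
apply: eq_bigr => j _; rewrite -!skewME skewMM skew_evalM1 rmorphM exprD.
by rewrite -!mulrA; congr (_ * _); rewrite !mulrA skew_eval_twist.
Qed.

Lemma skew_eval_is_zmod_morphism : zmod_morphism ev.
Proof.
move=> p q; apply: (addIr (ev q)); rewrite -skew_evalD.
by rewrite !subrK.
Qed.

Lemma skew_eval_is_monoid_morphism : monoid_morphism ev.
Proof.
by split; [rewrite -(rmorph1 (skewC nu)) skew_evalC rmorph1|exact: skew_evalM].
Qed.

End SkewEval.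

(* Formal expressions in the elements of D and the two generators. *)
Inductive dterm (D : Type) : Type :=
| DCoef of D
| DX
| DY
| DOpp of dterm D
| DAdd of dterm D & dterm D
| DMul of dterm D & dterm D.
Arguments DX {D}.
Arguments DY {D}.

HB.instance Definition _ (D : Type) := gen_eqMixin (dterm D).
HB.instance Definition _ (D : Type) := gen_choiceMixin (dterm D).

Section Diskew.
Variables (D : nzRingType) (sigma tau : D -> D) (b rho : D).

(* The least ring congruence on expressions making DCoef a ring morphism
   and imposing the defining relations. *)
Inductive dcong : dterm D -> dterm D -> Prop :=
| dc_refl s : dcong s s
| dc_sym s t : dcong s t -> dcong t s
| dc_trans s t w : dcong s t -> dcong t w -> dcong s w
| dc_opp s s' : dcong s s' -> dcong (DOpp s) (DOpp s')
| dc_add s s' t t' :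
    dcong s s' -> dcong t t' -> dcong (DAdd s t) (DAdd s' t')
| dc_mul s s' t t' :
    dcong s s' -> dcong t t' -> dcong (DMul s t) (DMul s' t')
| dc_addA s t w : dcong (DAdd s (DAdd t w)) (DAdd (DAdd s t) w)
| dc_addC s t : dcong (DAdd s t) (DAdd t s)
| dc_add0 s : dcong (DAdd (DCoef 0) s) s
| dc_addN s : dcong (DAdd (DOpp s) s) (DCoef 0)
| dc_mulA s t w : dcong (DMul s (DMul t w)) (DMul (DMul s t) w)
| dc_mul1l s : dcong (DMul (DCoef 1) s) s
| dc_mul1r s : dcong (DMul s (DCoef 1)) s
| dc_mulDl s t w :
    dcong (DMul (DAdd s t) w) (DAdd (DMul s w) (DMul t w))
| dc_mulDr s t w :
    dcong (DMul s (DAdd t w)) (DAdd (DMul s t) (DMul s w))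
| dc_coefD c d : dcong (DCoef (c + d)) (DAdd (DCoef c) (DCoef d))
| dc_coefM c d : dcong (DCoef (c * d)) (DMul (DCoef c) (DCoef d))
| dc_xd d : dcong (DMul DX (DCoef d)) (DMul (DCoef (sigma d)) DX)
| dc_yd d : dcong (DMul DY (DCoef d)) (DMul (DCoef (tau d)) DY)
| dc_xy : dcong (DAdd (DMul DX DY) (DOpp (DMul (DCoef rho) (DMul DY DX))))
                (DCoef b).

Definition dcongb : rel (dterm D) := fun s t => `[< dcong s t >].

Fact dcongb_refl : reflexive dcongb.
Proof. by move=> s; apply/asboolP; apply: dc_refl. Qed.
Fact dcongb_sym : symmetric dcongb.
Proof. by move=> s t; apply: asbool_equiv_eq; split; apply: dc_sym. Qed.
Fact dcongb_trans : transitive dcongb.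
Proof.
move=> t s w /asboolP st /asboolP tw; apply/asboolP; exact: dc_trans st tw.
Qed.

Canonical dcong_equiv := EquivRel dcongb dcongb_refl dcongb_sym dcongb_trans.

(* E = D[x, y; sigma, tau, b, rho] *)
Definition diskew : Type := {eq_quot dcong_equiv}.

HB.instance Definition _ : Choice diskew := Choice.on diskew.
HB.instance Definition _ := Quotient.on diskew.

Definition dpi (s : dterm D) : diskew := \pi_diskew s.

Lemma dpiP s t : dcong s t <-> dpi s = dpi t.
Proof.
split=> [st|/eqmodP]; first by apply/eqmodP/asboolP.
by move/asboolP.
Qed.

Lemma dpiK (x : diskew) : dpi (repr x) = x.
Proof. exact: reprK. Qed.

Lemma dcong_repr s : dcong (repr (dpi s)) s.
Proof. by apply/dpiP; rewrite dpiK. Qed.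

Definition diskew_opp (x : diskew) := dpi (DOpp (repr x)).
Definition diskew_add (x y : diskew) := dpi (DAdd (repr x) (repr y)).
Definition diskew_mul (x y : diskew) := dpi (DMul (repr x) (repr y)).

Lemma dpi_opp s : dpi (DOpp s) = diskew_opp (dpi s).
Proof. by apply/esym/dpiP/dc_opp/dcong_repr. Qed.
Lemma dpi_add s t : dpi (DAdd s t) = diskew_add (dpi s) (dpi t).
Proof. by apply/esym/dpiP; apply: dc_add; apply: dcong_repr. Qed.
Lemma dpi_mul s t : dpi (DMul s t) = diskew_mul (dpi s) (dpi t).
Proof. by apply/esym/dpiP; apply: dc_mul; apply: dcong_repr. Qed.

Fact diskew_addA : associative diskew_add.
Proof.
move=> x y z; rewrite -[x]dpiK -[y]dpiK -[z]dpiK -!dpi_add.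
by apply/dpiP; apply: dc_addA.
Qed.
Fact diskew_addC : commutative diskew_add.
Proof.
move=> x y; rewrite -[x]dpiK -[y]dpiK -!dpi_add.
by apply/dpiP; apply: dc_addC.
Qed.
Fact diskew_add0 : left_id (dpi (DCoef 0)) diskew_add.
Proof. by move=> x; rewrite -[x]dpiK -dpi_add; apply/dpiP; apply: dc_add0. Qed.
Fact diskew_addN : left_inverse (dpi (DCoef 0)) diskew_opp diskew_add.
Proof.
move=> x; rewrite -[x]dpiK -dpi_opp -dpi_add; apply/dpiP; exact: dc_addN.
Qed.
Fact diskew_mulA : associative diskew_mul.
Proof.
move=> x y z; rewrite -[x]dpiK -[y]dpiK -[z]dpiK -!dpi_mul.
by apply/dpiP; apply: dc_mulA.
Qed.
Fact diskew_mul1l : left_id (dpi (DCoef 1)) diskew_mul.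
Proof. by move=> x; rewrite -[x]dpiK -dpi_mul; apply/dpiP; apply: dc_mul1l. Qed.
Fact diskew_mul1r : right_id (dpi (DCoef 1)) diskew_mul.
Proof. by move=> x; rewrite -[x]dpiK -dpi_mul; apply/dpiP; apply: dc_mul1r. Qed.
Fact diskew_mulDl : left_distributive diskew_mul diskew_add.
Proof.
move=> x y z; rewrite -[x]dpiK -[y]dpiK -[z]dpiK -!(dpi_mul, dpi_add).
by apply/dpiP; apply: dc_mulDl.
Qed.
Fact diskew_mulDr : right_distributive diskew_mul diskew_add.
Proof.
move=> x y z; rewrite -[x]dpiK -[y]dpiK -[z]dpiK -!(dpi_mul, dpi_add).
by apply/dpiP; apply: dc_mulDr.
Qed.

HB.instance Definition _ := GRing.isPzRing.Build diskew
  diskew_addA diskew_addC diskew_add0 diskew_addN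
  diskew_mulA diskew_mul1l diskew_mul1r diskew_mulDl diskew_mulDr.

Definition diskewC (d : D) : diskew := dpi (DCoef d).
Definition diskewX : diskew := dpi DX.
Definition diskewY : diskew := dpi DY.

Lemma diskewCD c d : diskewC (c + d) = diskewC c + diskewC d.
Proof. by rewrite -[RHS]dpi_add; apply/dpiP; apply: dc_coefD. Qed.

Fact diskewC_is_zmod_morphism : zmod_morphism diskewC.
Proof. by move=> c d; apply: (addIr (diskewC d)); rewrite -diskewCD !subrK. Qed.

Fact diskewC_is_monoid_morphism : monoid_morphism diskewC.
Proof.
by split=> // c d; rewrite -[RHS]dpi_mul; apply/dpiP; apply: dc_coefM.
Qed.

HB.instance Definition _ :=
  GRing.isZmodMorphism.Build D diskew diskewC diskewC_is_zmod_morphism.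
HB.instance Definition _ :=
  GRing.isMonoidMorphism.Build D diskew diskewC diskewC_is_monoid_morphism.

Lemma diskewXC d : diskewX * diskewC d = diskewC (sigma d) * diskewX.
Proof. by rewrite -[LHS]dpi_mul -[RHS]dpi_mul; apply/dpiP; apply: dc_xd. Qed.

Lemma diskewYC d : diskewY * diskewC d = diskewC (tau d) * diskewY.
Proof. by rewrite -[LHS]dpi_mul -[RHS]dpi_mul; apply/dpiP; apply: dc_yd. Qed.

Lemma diskewXY :
  diskewX * diskewY - diskewC rho * diskewY * diskewX = diskewC b.
Proof.
rewrite -[_ * diskewY * _]mulrA -[diskewX * _]dpi_mul.
rewrite -[diskewY * _]dpi_mul -[diskewC rho * _]dpi_mul -[- _]dpi_opp.
by rewrite -[LHS]dpi_add; apply/dpiP; apply: dc_xy.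
Qed.

End Diskew.

Section HSubring.
Variables (D : unitRingType) (sigma tau : {rmorphism D -> D}) (b rho : D).

Definition nu_endo : {rmorphism D -> D} := tau \o sigma.
Definition mu_endo : {rmorphism D -> D} := sigma \o tau.

Definition hring := skewpoly nu_endo.
HB.instance Definition _ := GRing.NzRing.on hring.

Definition hC (d : D) : hring := skewC nu_endo d.
HB.instance Definition _ := GRing.RMorphism.copy hC (skewC nu_endo).

Definition hX : hring := skewX nu_endo.

Definition hX' : hring := hC rho * hX + hC b.

Definition sigma_ext : hring -> hring := skew_eval (hC \o sigma) hX'.

Definition tau_ext : hring -> hring :=
  skew_eval (hC \o tau) (hC (tau rho^-1) * (hX - hC (tau b))).

(* a_i, b_i, a'_i, b'_i for i >= 1; see iter_sigma_ext and iter_tau_ext. *)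
Definition coef_a (i : nat) : D := \prod_(j < i) iter (i.-1 - j) sigma rho.
Definition coef_b (i : nat) : D :=
  \sum_(1 <= j < i) iter j sigma (coef_a (i - j)) * iter j.-1 sigma b
  + iter i.-1 sigma b.
Definition coef_a' (i : nat) : D := \prod_(j < i) iter (i - j) tau rho^-1.
Definition coef_b' (i : nat) : D :=
  - (\sum_(1 <= j < i) iter j tau (coef_a' (i - j)) * iter j tau (rho^-1 * b))
  - iter i tau (rho^-1 * b).

(* The embedding of D[h; nu] in E, with h = yx. *)
Definition hring_inE : hring -> diskew sigma tau b rho :=
  skew_eval (@diskewC D sigma tau b rho)
            (diskewY sigma tau b rho * diskewX sigma tau b rho).

Hypothesis rhoP : forall d, sigma (tau d) * rho = rho * tau (sigma d).
Hypothesis bP : forall d, sigma (tau d) * b = b * d.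

Lemma hX'C d : hX' * hC d = hC (sigma (tau d)) * hX'.
Proof.
rewrite mulrDl mulrDr -mulrA skewXC !mulrA -!rmorphM.
by rewrite rhoP bP.
Qed.

Lemma sigma_ext_twist d :
  hX' * (hC \o sigma) d = (hC \o sigma) (nu_endo d) * hX'.
Proof. by rewrite hX'C. Qed.

Lemma sigma_extC d : sigma_ext (hC d) = hC (sigma d).
Proof. exact: skew_evalC. Qed.
Lemma sigma_extX : sigma_ext hX = hX'.
Proof. exact: skew_evalX. Qed.
Lemma sigma_ext_is_zmod_morphism : zmod_morphism sigma_ext.
Proof. exact: skew_eval_is_zmod_morphism. Qed.
Lemma sigma_ext_is_monoid_morphism : monoid_morphism sigma_ext.
Proof. exact: skew_eval_is_monoid_morphism sigma_ext_twist. Qed.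

Lemma sigma_extD : {morph sigma_ext : p q / p + q}.
Proof. exact: skew_evalD. Qed.
Lemma sigma_extM : {morph sigma_ext : p q / p * q}.
Proof. exact: sigma_ext_is_monoid_morphism.2. Qed.

Lemma coef_aS i : coef_a i.+1 = iter i sigma rho * coef_a i.
Proof.
rewrite /coef_a big_ord_recl subn0; congr (_ * _).
case: i => [|i]; first by rewrite !big_ord0.
by apply: eq_bigr => j _; rewrite lift0 subSS.
Qed.

Lemma coef_bS i : (0 < i)%N ->
  coef_b i.+1 = iter i sigma rho * coef_b i + iter i sigma b.
Proof.
case: i => // i _; rewrite /coef_b big_nat_recr //=; congr (_ + _).
rewrite mulrDr big_distrr /=; congr (_ + _); last first.
  by rewrite subSnn /coef_a big_ord1 -iterS.
apply: eq_big_nat => j /andP[_ lt_ji].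
rewrite subSn ?coef_aS ?iter_rmorphM -?iterD ?subnKC ?mulrA //; exact: ltnW.
Qed.

Lemma iter_sigma_ext i : (0 < i)%N ->
  iter i sigma_ext hX = hC (coef_a i) * hX + hC (coef_b i).
Proof.
have itC k d : iter k sigma_ext (hC d) = hC (iter k sigma d).
  by elim: k => //= k ->; rewrite sigma_extC.
have itD k p q : iter k sigma_ext (p + q) =
    iter k sigma_ext p + iter k sigma_ext q.
  by elim: k => //= k ->; rewrite sigma_extD.
have itM k p q : iter k sigma_ext (p * q) =
    iter k sigma_ext p * iter k sigma_ext q.
  by elim: k => //= k ->; rewrite sigma_extM.
case: i => // i _; elim: i => [|i IH].
  by rewrite /= sigma_extX /hX' /coef_a /coef_b big_ord1 big_geq //= add0r.
rewrite coef_aS coef_bS // iterSr sigma_extX itD itM !itC IH mulrDr mulrA.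
by rewrite -!rmorphM -addrA -rmorphD.
Qed.

Hypothesis rhoU : rho \is a GRing.unit.

Lemma tau_ext_twist d :
  hC (tau rho^-1) * (hX - hC (tau b)) * (hC \o tau) d =
  (hC \o tau) (nu_endo d) * (hC (tau rho^-1) * (hX - hC (tau b))).
Proof.
have rV c : rho^-1 * sigma (tau c) = tau (sigma c) * rho^-1.
  by apply: (mulrI rhoU); rewrite mulVKr // mulrA -rhoP mulrK.
rewrite /= mulrA -rmorphM -rmorphM -rV -mulrA mulrBl skewXC -rmorphM -rmorphM -bP.
by rewrite !rmorphM /= -!mulrA -mulrBr.
Qed.

Lemma tau_extC d : tau_ext (hC d) = hC (tau d).
Proof. exact: skew_evalC. Qed.
Lemma tau_extX : tau_ext hX = hC (tau rho^-1) * (hX - hC (tau b)).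
Proof. exact: skew_evalX. Qed.
Lemma tau_ext_is_zmod_morphism : zmod_morphism tau_ext.
Proof. exact: skew_eval_is_zmod_morphism. Qed.
Lemma tau_ext_is_monoid_morphism : monoid_morphism tau_ext.
Proof. exact: skew_eval_is_monoid_morphism tau_ext_twist. Qed.

Lemma tau_extD : {morph tau_ext : p q / p + q}.
Proof. exact: skew_evalD. Qed.
Lemma tau_extM : {morph tau_ext : p q / p * q}.
Proof. exact: tau_ext_is_monoid_morphism.2. Qed.

Lemma coef_a'S i : coef_a' i.+1 = iter i.+1 tau rho^-1 * coef_a' i.
Proof. by rewrite /coef_a' big_ord_recl subn0. Qed.

Lemma coef_b'S i : (0 < i)%N ->
  coef_b' i.+1 =
  iter i.+1 tau rho^-1 * coef_b' i - iter i.+1 tau (rho^-1 * b).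
Proof.
case: i => // i _; rewrite /coef_b' big_nat_recr //=; congr (_ - _).
rewrite mulrDr !mulrN big_distrr -opprD; congr (- (_ + _)); last first.
  by rewrite subSnn /coef_a' big_ord1 -!iterS -iterSr.
apply: eq_big_nat => j /andP[_ lt_ji].
have le_ji := ltnW lt_ji.
by rewrite subSn // coef_a'S iter_rmorphM -iterD addnS subnKC // -mulrA.
Qed.

Lemma iter_tau_ext i : (0 < i)%N ->
  iter i tau_ext hX = hC (coef_a' i) * hX + hC (coef_b' i).
Proof.
have itC k d : iter k tau_ext (hC d) = hC (iter k tau d).
  by elim: k => //= k ->; rewrite tau_extC.
have itD k p q : iter k tau_ext (p + q) =
    iter k tau_ext p + iter k tau_ext q.
  by elim: k => //= k ->; rewrite tau_extD.
have itM k p q : iter k tau_ext (p * q) =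
    iter k tau_ext p * iter k tau_ext q.
  by elim: k => //= k ->; rewrite tau_extM.
have tauX : tau_ext hX = hC (tau rho^-1) * hX + hC (- tau (rho^-1 * b)).
  by rewrite tau_extX mulrBr -rmorphM -rmorphM rmorphN.
case: i => // i _; elim: i => [|i IH].
  by rewrite /= tauX /coef_a' /coef_b' big_ord1 big_geq //= oppr0 add0r.
rewrite coef_a'S coef_b'S // iterSr tauX itD itM !itC IH mulrDr mulrA.
rewrite iter_rmorphN -!iterSr [LHS]/= -addrA.
by rewrite -rmorphM -rmorphM -rmorphD.
Qed.

Lemma sigma_tau_ext p : sigma_ext (tau_ext p) * hX' = hX' * p.
Proof.
have mulP q r : sigma_ext (tau_ext q) * hX' = hX' * q ->
    sigma_ext (tau_ext r) * hX' = hX' * r ->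
    sigma_ext (tau_ext (q * r)) * hX' = hX' * (q * r).
  by move=> Eq Er; rewrite tau_extM sigma_extM -mulrA Er mulrA Eq mulrA.
have PC d : sigma_ext (tau_ext (hC d)) * hX' = hX' * hC d.
  by rewrite tau_extC sigma_extC hX'C.
have PX : sigma_ext (tau_ext hX) * hX' = hX' * hX.
  have EX : hX = hC rho^-1 * (hX' - hC b).
    by rewrite /hX' addrK mulrA -rmorphM mulVr // rmorph1 mul1r.
  rewrite tau_extX sigma_extM sigma_extC.
  rewrite (sigma_ext_is_zmod_morphism hX) sigma_extX sigma_extC.
  rewrite [in RHS]EX mulrA hX'C -!mulrA; congr (_ * _).
  by rewrite mulrBl mulrBr hX'C.
have P0 : sigma_ext (tau_ext 0) * hX' = hX' * 0.
  by rewrite -(rmorph0 hC) PC.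
have PXn n : sigma_ext (tau_ext (hX ^+ n)) * hX' = hX' * hX ^+ n.
  elim: n => [|n IH]; last by rewrite exprS; apply: mulP.
  by rewrite expr0 -(rmorph1 hC).
rewrite [p]skewpolyE.
apply: (big_ind (fun q => sigma_ext (tau_ext q) * hX' = hX' * q)) => //.
- by move=> q r Eq Er; rewrite tau_extD sigma_extD mulrDl Eq Er -mulrDr.
- by move=> i _; apply: mulP; [exact: PC | exact: PXn].
Qed.

Lemma tau_sigma_ext p : tau_ext (sigma_ext p) * hX = hX * p.
Proof.
have mulP q r : tau_ext (sigma_ext q) * hX = hX * q ->
    tau_ext (sigma_ext r) * hX = hX * r ->
    tau_ext (sigma_ext (q * r)) * hX = hX * (q * r).
  by move=> Eq Er; rewrite sigma_extM tau_extM -mulrA Er mulrA Eq mulrA.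
have PC d : tau_ext (sigma_ext (hC d)) * hX = hX * hC d.
  by rewrite sigma_extC tau_extC [RHS]skewXC.
have PX : tau_ext (sigma_ext hX) * hX = hX * hX.
  congr (_ * _); rewrite sigma_extX tau_extD tau_extM !tau_extC tau_extX.
  by rewrite mulrA -!rmorphM mulrV // !rmorph1 mul1r subrK.
have P0 : tau_ext (sigma_ext 0) * hX = hX * 0.
  by rewrite -(rmorph0 hC) PC.
have PXn n : tau_ext (sigma_ext (hX ^+ n)) * hX = hX * hX ^+ n.
  elim: n => [|n IH]; last by rewrite exprS; apply: mulP.
  by rewrite expr0 -(rmorph1 hC).
rewrite [p]skewpolyE.
apply: (big_ind (fun q => tau_ext (sigma_ext q) * hX = hX * q)) => //.
- by move=> q r Eq Er; rewrite sigma_extD tau_extD mulrDl Eq Er -mulrDr.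
- by move=> i _; apply: mulP; [exact: PC | exact: PXn].
Qed.

Local Notation E := (diskew sigma tau b rho).
Local Notation x := (diskewX sigma tau b rho).
Local Notation y := (diskewY sigma tau b rho).

Lemma hring_inE_twist d :
  (y * x) * diskewC sigma tau b rho d =
  diskewC sigma tau b rho (nu_endo d) * (y * x).
Proof. by rewrite -mulrA diskewXC mulrA diskewYC -mulrA. Qed.

Lemma hring_inEC d : hring_inE (hC d) = diskewC sigma tau b rho d.
Proof. exact: skew_evalC. Qed.
Lemma hring_inEX : hring_inE hX = y * x.
Proof. exact: skew_evalX. Qed.
Lemma hring_inE_is_zmod_morphism : zmod_morphism hring_inE.
Proof. exact: skew_eval_is_zmod_morphism. Qed.
Lemma hring_inE_is_monoid_morphism : monoid_morphism hring_inE.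
Proof. exact: skew_eval_is_monoid_morphism hring_inE_twist. Qed.

Lemma hring_inEX' : hring_inE hX' = x * y.
Proof.
have -> : hring_inE hX' = hring_inE (hC rho * hX) + hring_inE (hC b).
  exact: skew_evalD.
rewrite hring_inE_is_monoid_morphism.2 !hring_inEC hring_inEX.
by rewrite -diskewXY mulrA addrC subrK.
Qed.

(* E acts on D[h; nu] by letting D act by left multiplication, x as sigma and
   y as p |-> tau(p) h; then yx acts as left multiplication by h. *)
Fixpoint dact (t : dterm D) (p : hring) : hring :=
  match t with
  | DCoef d => hC d * p
  | DX => sigma_ext p
  | DY => tau_ext p * hX
  | DOpp s => - dact s p
  | DAdd s s' => dact s p + dact s' p
  | DMul s s' => dact s (dact s' p)
  end.

Lemma dactD t : {morph dact t : p q / p + q}.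
Proof.
elim: t => [d|||s IH|s IH s' IH'|s IH s' IH'] p q /=.
- by rewrite mulrDr.
- exact: sigma_extD.
- by rewrite tau_extD mulrDl.
- by rewrite IH opprD.
- by rewrite IH IH' addrACA.
- by rewrite IH' IH.
Qed.

Lemma dact_cong s t : dcong sigma tau b rho s t -> dact s =1 dact t.
Proof.
elim=> {s t} /=.
- by [].
- by move=> s t _ IH p; rewrite IH.
- by move=> s t w _ IH _ IH' p; rewrite IH.
- by move=> s s' _ IH p /=; rewrite IH.
- by move=> s s' t t' _ IH _ IH' p /=; rewrite IH IH'.
- by move=> s s' t t' _ IH _ IH' p /=; rewrite IH' IH.
- by move=> s t w p /=; rewrite addrA.
- by move=> s t p /=; rewrite addrC.
- by move=> s p /=; rewrite rmorph0 mul0r add0r.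
- by move=> s p /=; rewrite addNr rmorph0 mul0r.
- by [].
- by move=> s p /=; rewrite rmorph1 mul1r.
- by move=> s p /=; rewrite rmorph1 mul1r.
- by [].
- by move=> s t w p /=; rewrite dactD.
- by move=> c d p /=; rewrite rmorphD mulrDl.
- by move=> c d p /=; rewrite rmorphM mulrA.
- by move=> d p /=; rewrite sigma_extM sigma_extC.
- by move=> d p /=; rewrite tau_extM tau_extC mulrA.
- move=> p /=; rewrite sigma_extM sigma_extX sigma_tau_ext tau_sigma_ext.
  by rewrite mulrA -mulrBl /hX' addrC addKr.
Qed.

Lemma hring_inE_inj : injective hring_inE.
Proof.
pose act (e : E) := dact (repr e).
have actP s : act (dpi sigma tau b rho s) =1 dact s.
  by apply: dact_cong; apply: dcong_repr.
have actD e e' p : act (e + e') p = act e p + act e' p.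
  by rewrite -[e]dpiK -[e']dpiK -[_ + _]dpi_add !actP.
have actM e e' p : act (e * e') p = act e (act e' p).
  rewrite -[e]dpiK -[e']dpiK -[_ * _]dpi_mul !actP /=.
  by rewrite /act; congr dact; apply/esym/actP.
have actC d p : act (diskewC sigma tau b rho d) p = hC d * p by rewrite actP.
have actX p : act (y * x) p = hX * p by rewrite actM !actP /= tau_sigma_ext.
have actXn n p : act ((y * x) ^+ n) p = hX ^+ n * p.
  elim: n => [|n IH]; last by rewrite !exprS actM actX IH mulrA.
  by rewrite !expr0 -(rmorph1 (diskewC sigma tau b rho)) actC rmorph1.
suff actE q : act (hring_inE q) 1 = q.
  by move=> p q Epq; rewrite -[p]actE Epq actE.
rewrite [RHS]skewpolyE /hring_inE /skew_eval.
apply: (big_ind2 (fun e r => act e 1 = r)).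
- by rewrite -(rmorph0 (diskewC sigma tau b rho)) actC rmorph0 mul0r.
- by move=> e r e' r' Ee Ee'; rewrite actD Ee Ee'.
- by move=> i _; rewrite actM actC actXn mulr1.
Qed.

End HSubring.

Arguments sigma_ext {D} sigma tau b rho _.
Arguments tau_ext {D} sigma tau b rho _.
Arguments hring_inE {D} sigma tau b rho _.

(* Main.v *)
From HB Require Import structures.
Require Import Defs.
From mathcomp Require Import all_boot all_order all_algebra.
From mathcomp Require Import boolp zify.

Set Implicit Arguments.
Unset Strict Implicit.
Unset Printing Implicit Defensive.

Import GRing.Theory.
Local Open Scope ring_scope.

(** Write DD for the ring D[h; nu]. In E one has x p = sigma(p) x and
    y p = tau(p) y for p in DD, so E is spanned over DD by the powers of x and
    of y, and y behaves like h x^-1.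

    From [cond2] to simplicity. Let I be a nonzero ideal of E. If e in I
    is nonzero, then e x^n is, for n large, the value of a nonzero polynomial
    in x over DD ([clear_denominator]); so I pulls back to a nonzero ideal of
    DD[X; sigma], which may be enlarged by allowing cancellation of powers of
    X on the right. The leading coefficients of its elements of least degree m
    in X form a sigma-stable ideal L of DD. The leading coefficients of the
    elements of L of least degree n in h form a sigma-stable ideal of D, so L
    contains a monic p of degree n. Minimality of n gives p d = nu^n(d) p for
    d in D, and makes sigma(p) a left multiple of p by an element of D; also
    h p = p h, because nu is conjugation by the unit sigma^-1(b). As [cond2]
    excludes such p for n > 0, n = 0 ([hring_ideal_full]). Hence there is a
    monic F of degree m in X; now F h - sigma^m(h) F has smaller degree, hence
    is 0, and this forces every lower coefficient of F to vanish since the b_i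
    are units ([comm_affine_eq0]). So x^N lies in I for some N
    ([skew_ideal_Xn]), and x^k y - a_k y x^k = b_k x^(k-1) brings the exponent
    down to 0 ([diskew_ideal_X_lower]).

    From simplicity to [cond2]. If e in E is nonzero, V is an E-module and
    N is a submodule containing e V, then N = V ([simple_submodule_full]). Two
    modules suffice. On DD let x act as sigma and y as p |-> tau(p) h. The
    polynomials with coefficients in a sigma- and tau-stable ideal K of D form
    a submodule, so K is trivial ([stable_ideal_trivial]); the union of the
    kernels of the powers of nu is such a K, hence sigma and tau are
    injective. A monic p of the kind that [cond2] excludes generates a proper
    submodule DD p containing p DD, a contradiction ([no_normal_poly]). The
    other module is E/Ex, with basis the y^j v: there
    x y^j v = beta_j y^(j-1) v, and were beta_(m+1) not a unit, a proper
    submodule would contain the image of y^(m+1) ([beta_unit]); these beta_j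
    are the b_j up to sigma^(j-1).
    Finally, once b is a unit, tau is the inverse of sigma up to conjugation,
    so sigma-stable ideals are controlled by ideals stable under both
    ([sigma_simple]).

    [cond3] is [cond2] for the ring
    D[y, x; tau, sigma, -rho^-1 b, rho^-1], which is E with the two generators
    exchanged ([simple_swap], [criterion_swap]). *)

Local Notation coefs p i := ((skewcoef p%R)`_i).
Local Notation ssize p := (size (skewcoef p%R)).

(** * Coefficients and leading terms of skew polynomials *)

Section SkewCoefficients.
Variables (R : nzRingType) (s : {rmorphism R -> R}).
Implicit Types p q : skewpoly s.

Lemma coefs_Mmul d j p k :
  coefs (skewM s d j * p) k =
  if (k < j)%N then 0 else d * iter j s (coefs p (k - j)).
Proof.
rewrite coef_skew_mul; case: ltnP => [lt_kj|le_jk].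
  rewrite big1 // => i _; rewrite coef_skewM ltn_eqF ?mul0r //.
  by rewrite (leq_ltn_trans _ lt_kj) // -ltnS.
rewrite (bigD1 (Ordinal (le_jk : (j < k.+1)%N))) // coef_skewM eqxx.
rewrite big1 => [|i /negPf ne_ij]; first by rewrite /= addr0.
rewrite coef_skewM.
by have -> : (i == j :> nat) = false by []; rewrite mul0r.
Qed.

Lemma coefs_mulM d j p k :
  coefs (p * skewM s d j) k =
  if (k < j)%N then 0 else coefs p (k - j) * iter (k - j) s d.
Proof.
rewrite coef_skew_mul_rev; case: ltnP => [lt_kj|le_jk].
  rewrite big1 // => i _; rewrite coef_skewM ltn_eqF ?iter_rmorph0 ?mulr0 //.
  by rewrite (leq_ltn_trans _ lt_kj) // -ltnS.
rewrite (bigD1 (Ordinal (le_jk : (j < k.+1)%N))) // coef_skewM eqxx.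
rewrite big1 => [|i /negPf ne_ij]; first by rewrite /= addr0.
rewrite coef_skewM.
by have -> : (i == j :> nat) = false by []; rewrite iter_rmorph0 mulr0.
Qed.

Lemma coefsD p q k : coefs (p + q) k = coefs p k + coefs q k.
Proof. exact: coefD. Qed.

Lemma coefsB p q k : coefs (p - q) k = coefs p k - coefs q k.
Proof. exact: coefB. Qed.

Lemma coefs_sum (I : Type) (r : seq I) (P : pred I) (F : I -> skewpoly s) k :
  coefs (\sum_(i <- r | P i) F i) k = \sum_(i <- r | P i) coefs (F i) k.
Proof. by rewrite raddf_sum coef_sum. Qed.

Lemma coefs_Cmul d p k : coefs (skewC s d * p) k = d * coefs p k.
Proof. by rewrite skewCE coefs_Mmul subn0. Qed.

Lemma coefs_mulC d p k : coefs (p * skewC s d) k = coefs p k * iter k s d.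
Proof. by rewrite skewCE coefs_mulM subn0. Qed.

Lemma coefs_mulXn n p k :
  coefs (p * skewX s ^+ n) k = if (k < n)%N then 0 else coefs p (k - n).
Proof. by rewrite skewXn coefs_mulM iter_rmorph1 mulr1. Qed.

Lemma coefs_mulX p k :
  coefs (p * skewX s) k = if k is k'.+1 then coefs p k' else 0.
Proof.
by rewrite -[skewX s]expr1 coefs_mulXn; case: k => // k; rewrite subn1.
Qed.

Lemma coefs_Xmul p k :
  coefs (skewX s * p) k = if k is k'.+1 then s (coefs p k') else 0.
Proof.
by rewrite skewXE coefs_Mmul; case: k => [|k] //=; rewrite mul1r subn1.
Qed.

Lemma ssizeP n p :
  reflect (forall i, (n <= i)%N -> coefs p i = 0) (ssize p <= n)%N.
Proof. exact: leq_sizeP. Qed.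

(** The top coefficient of a product, in a form that does not mention exact
    degrees: the coefficients at [i] and [j] may vanish. *)
Lemma coefs_mul_lead i j p q : (ssize p <= i.+1)%N -> (ssize q <= j.+1)%N ->
  (ssize (p * q) <= (i + j).+1)%N /\
  coefs (p * q) (i + j) = coefs p i * iter i s (coefs q j).
Proof.
move=> lpi lqj; split.
  by apply: leq_trans (size_poly _ _) _; lia.
have lti : (i < (i + j).+1)%N by rewrite ltnS leq_addr.
rewrite coef_skew_mul (bigD1 (Ordinal lti)) // addKn.
rewrite big1 => [|k ne_ki]; first by rewrite /= addr0.
have {ne_ki} ne_ki : (k : nat) <> i.
  by move=> E; case/eqP: ne_ki; apply: val_inj.
have [lt_ik|le_ki] := ltnP i k.
  by rewrite nth_default ?mul0r // (leq_trans lpi).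
rewrite [X in iter _ _ X]nth_default ?iter_rmorph0 ?mulr0 //.
by apply: leq_trans lqj _; lia.
Qed.
End SkewCoefficients.

Section SkewEvalLead.
Variables (R : nzRingType) (s1 s2 f : {rmorphism R -> R}) (u : skewpoly s2).
Hypothesis size_u : (ssize u <= 2)%N.

Lemma coefs_exp_lead n :
  (ssize (u ^+ n) <= n.+1)%N /\
  coefs (u ^+ n) n = \prod_(j < n) iter j s2 (coefs u 1).
Proof.
elim: n => [|n [size_un lead_un]].
  by rewrite expr0 big_ord0 coef1 size_poly1.
have [] := coefs_mul_lead size_u size_un.
rewrite exprS big_ord_recl add1n => -> ->; split=> //=.
by rewrite lead_un rmorph_prod.
Qed.

(** Substituting [u] of degree at most 1 for the variable cannot raise the
    degree. This covers the extensions of [sigma] and [tau] to D[h; nu] and the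
    passage from [h] to [h']. *)
Lemma skew_eval_lead n (p : skewpoly s1) : (ssize p <= n.+1)%N ->
  (ssize (skew_eval (skewC s2 \o f) u p) <= n.+1)%N /\
  coefs (skew_eval (skewC s2 \o f) u p) n =
    f (coefs p n) * \prod_(j < n) iter j s2 (coefs u 1).
Proof.
move=> lpn; rewrite (skew_eval_wide _ _ lpn); split.
  apply/ssizeP => i lt_ni; rewrite coefs_sum big1 // => j _.
  rewrite coefs_Cmul (ssizeP _ _ (coefs_exp_lead j).1) ?mulr0 //.
  exact: leq_trans (ltn_ord j) lt_ni.
rewrite coefs_sum big_ord_recr big1 /= ?add0r => [|j _].
  by rewrite coefs_Cmul (coefs_exp_lead n).2.
by rewrite coefs_Cmul (ssizeP _ _ (coefs_exp_lead j).1) ?mulr0.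
Qed.

End SkewEvalLead.

Lemma unitr_iter (R : unitRingType) (f : {rmorphism R -> R}) n x :
  x \is a GRing.unit -> iter n f x \is a GRing.unit.
Proof. by move=> xU; elim: n => //= n IH; apply: rmorph_unit. Qed.

Lemma unitr_prod_iter (R : unitRingType) (f : {rmorphism R -> R}) n x :
  x \is a GRing.unit -> \prod_(i < n) iter i f x \is a GRing.unit.
Proof. by move=> xU; apply: rpred_prod => i _; apply: unitr_iter. Qed.

(** Descent on the degree: the hypothesis kills the coefficient at every bound
    on the degree, so every such bound can be lowered. *)
Lemma ssize_ind (R : nzRingType) (s : {rmorphism R -> R}) (p : skewpoly s) :
  (forall n, (ssize p <= n.+1)%N -> coefs p n = 0) -> p = 0.
Proof.
move=> top0; suff lpn n : (ssize p <= n)%N -> p = 0 by apply: lpn (leqnn _).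
elim: n => [|n IH] lpn.
  by apply: skewpolyP => i; rewrite coef0 (ssizeP _ _ lpn).
apply: IH; apply/ssizeP => i; rewrite leq_eqVlt => /predU1P[<-|lt_ni].
  exact: top0.
exact: (ssizeP _ _ lpn).
Qed.

Lemma skew_eval_eq0 (R : unitRingType) (s1 s2 f : {rmorphism R -> R})
    (u : skewpoly s2) (p : skewpoly s1) :
  injective f -> (ssize u <= 2)%N -> coefs u 1 \is a GRing.unit ->
  skew_eval (skewC s2 \o f) u p = 0 -> p = 0.
Proof.
move=> inj_f size_u uU ev0; apply: ssize_ind => n lpn; apply: inj_f.
rewrite rmorph0; apply: (mulIr (unitr_prod_iter s2 n uU)).
by have [_ <-] := skew_eval_lead f size_u lpn; rewrite ev0 coef0 mul0r.
Qed.

Lemma mulr_lead_unit_eq0 (R : unitRingType) (s : {rmorphism R -> R}) j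
    (w q : skewpoly s) : (ssize w <= j.+1)%N ->
  coefs w j \is a GRing.unit -> q * w = 0 -> q = 0.
Proof.
move=> lw wU qw0; apply: ssize_ind => n lqn.
have [_] := coefs_mul_lead lqn lw; rewrite qw0 coef0 => /esym q_n.
by apply: (mulIr (unitr_iter s n wU)); rewrite q_n mul0r.
Qed.

Section LeadingIdeal.
Variables (R : nzRingType) (s : {rmorphism R -> R}) (I : skewpoly s -> Prop).
Hypothesis idealI : two_sided_ideal I.
Hypothesis s_surj : forall c, exists d, s d = c.

(** For [n] the least degree of a nonzero element of [I], these are the leading
    coefficients of the elements of that degree, together with 0. *)
Definition lead_coefs n c :=
  exists p, [/\ I p, (ssize p <= n.+1)%N & coefs p n = c].

Lemma iter_surj n c : exists d, iter n s d = c.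
Proof.
elim: n c => [|n IH] c; first by exists c.
by have [d <-] := s_surj c; have [e <-] := IH d; exists e.
Qed.

(** Surjectivity of [s] makes the set closed under right multiplication:
    multiplying by [d] on the right multiplies the coefficient at [n] by
    [iter n s d]. *)
Lemma lead_coefs_ideal n : two_sided_ideal (lead_coefs n).
Proof.
have [I0 ID IM] := idealI; split.
- by exists 0; rewrite size_poly0 coef0.
- move=> _ _ [p [Ip lp <-]] [q [Iq lq <-]]; exists (p + q).
  rewrite coefsD; split=> //; first exact: ID.
  by rewrite (leq_trans (size_polyD _ _)) ?geq_max ?lp.
- move=> a _ [p [Ip lp <-]]; split.
    exists (skewC s a * p); rewrite coefs_Cmul.
    split=> //; first exact: (IM _ _ Ip).1.
    by apply/ssizeP => i lt_ni; rewrite coefs_Cmul (ssizeP _ _ lp) ?mulr0.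
  have [d <-] := iter_surj n a; exists (p * skewC s d); rewrite coefs_mulC.
  split=> //; first exact: (IM _ _ Ip).2.
  by apply/ssizeP => i lt_ni; rewrite coefs_mulC (ssizeP _ _ lp) ?mul0r.
Qed.

Lemma min_degree p : I p -> p <> 0 ->
  exists n, (exists2 c, lead_coefs n c & c <> 0) /\
    (forall q, I q -> (ssize q <= n)%N -> q = 0).
Proof.
move=> Ip nz_p; pose P n := `[< exists q, [/\ I q, q <> 0 & ssize q = n.+1] >].
have exP : exists n, P n.
  exists (ssize p).-1; apply/asboolP; exists p; split=> //; rewrite prednK //.
  rewrite lt0n size_poly_eq0; apply/eqP => p0; apply: nz_p.
  by apply: skewpolyP => i; rewrite p0.
have [n /asboolP[q [Iq nz_q size_q]] min_n] := ex_minnP exP.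
exists n; split.
  exists (coefs q n); first by exists q; rewrite size_q.
  apply/eqP; rewrite -[n]/(n.+1.-1) -size_q -lead_coefE lead_coef_eq0.
  by apply/eqP => q0; apply: nz_q; apply: skewpolyP => i; rewrite q0.
move=> r Ir le_rn; apply/eqP; apply/negPn/negP => /eqP nz_r.
have size_r : ssize r = (ssize r).-1.+1.
  rewrite prednK // lt0n size_poly_eq0; apply/eqP => r0; apply: nz_r.
  by apply: skewpolyP => i; rewrite r0.
have := min_n (ssize r).-1; rewrite leqNgt -size_r -ltnS ltnS => H.
suff /H : P (ssize r).-1 by lia.
by apply/asboolP; exists r.
Qed.

End LeadingIdeal.

(** * Sigma-stable ideals of D[h; nu] *)

Lemma skewpolyE_wide (R : nzRingType) (s : {rmorphism R -> R}) n
    (p : skewpoly s) : (ssize p <= n)%N ->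
  p = \sum_(i < n) skewC s (coefs p i) * skewX s ^+ i.
Proof.
by move=> lpn; rewrite {1}[p]skewpolyE; apply: (skew_eval_wide (skewC s)).
Qed.

Lemma skewpoly_ind (R : nzRingType) (s : {rmorphism R -> R})
    (P : skewpoly s -> Prop) :
  (forall p q, P p -> P q -> P (p + q)) ->
  (forall p q, P p -> P q -> P (p * q)) ->
  (forall d, P (skewC s d)) -> P (skewX s) -> forall p, P p.
Proof.
move=> PD PM PC PX p; rewrite [p]skewpolyE; apply: (big_ind P) => //.
  by rewrite -(rmorph0 (skewC s)); apply: PC.
move=> i _; apply: (PM _ _); first exact: PC.
elim: (i : nat) => [|n IH]; last by rewrite exprS; apply: (PM _ _).
by rewrite expr0 -(rmorph1 (skewC s)); apply: (PC _).
Qed.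

Section HringIdeals.
Variables (D : unitRingType) (sigma tau : {rmorphism D -> D}) (b rho : D).
Local Notation nu := (nu_endo sigma tau).
Local Notation C := (hC sigma tau).
Local Notation h := (hX sigma tau).
Local Notation sigmaD := (sigma_ext sigma tau b rho).

(** When [nu] is onto and [rho] is a unit, such a [p] is normal in E:
    [p E = E p]. *)
Definition normal_poly n (d_ : 'I_n -> D) (p : hring sigma tau) :=
  [/\ p = h ^+ n + \sum_(i < n) C (d_ i) * h ^+ i,
      (forall d : D, p * C d = C (iter n nu d) * p),
      sigmaD p = C (\prod_(i < n) iter i nu rho) * p &
      h * p - p * h = 0].

Hypothesis rhoU : rho \is a GRing.unit.

Lemma coefs_hX'1 : coefs (hX' sigma tau b rho) 1 = rho.
Proof. by rewrite coefsD coefs_Cmul /= coefX coefC mulr1 addr0. Qed.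

Lemma ssize_hX' : (ssize (hX' sigma tau b rho) <= 2)%N.
Proof.
apply/ssizeP => -[|[|i]] // _.
by rewrite coefsD coefs_Cmul /= coefX coefC mulr0 addr0.
Qed.

Lemma sigma_ext_lead n (p : hring sigma tau) : (ssize p <= n.+1)%N ->
  (ssize (sigmaD p) <= n.+1)%N /\
  coefs (sigmaD p) n = sigma (coefs p n) * \prod_(j < n) iter j nu rho.
Proof.
by move=> lp; have := skew_eval_lead sigma ssize_hX' lp; rewrite coefs_hX'1.
Qed.

Lemma sigma_ext_inj : injective sigma -> injective sigmaD.
Proof.
move=> inj_s; suff inj0 p : sigmaD p = 0 -> p = 0.
  move=> p q /eqP; rewrite -subr_eq0 -(sigma_ext_is_zmod_morphism b rho).
  by move=> /eqP/inj0/eqP; rewrite subr_eq0 => /eqP.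
move=> sp0; apply: (skew_eval_eq0 inj_s ssize_hX') sp0.
by rewrite coefs_hX'1.
Qed.

Variable u : D.
Hypotheses (uU : u \is a GRing.unit) (nu_u : forall d, nu d * u = u * d).
Hypothesis simple_sigma : endo_simple sigma.
Hypothesis nu_surj : forall d, exists c, nu c = d.
Hypothesis no_normal : forall n, (0 < n)%N ->
  ~ exists (d_ : 'I_n -> D) p, normal_poly d_ p.

(** A monic element [p] of least degree in [J] exists by simplicity of [D], and
    its minimality makes it a [normal_poly], so its degree is 0. *)
Lemma hring_ideal_full (J : hring sigma tau -> Prop) :
  two_sided_ideal J -> (forall p, J p -> J (sigmaD p)) ->
  forall p, J p -> p <> 0 -> J 1.
Proof.
move=> idJ Jsigma p0 Jp0 nz_p0; have [J0 JD JM] := idJ.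
have JN q : J q -> J (- q) by move=> Jq; rewrite -mulN1r; exact: (JM _ _ Jq).1.
have [n [[c Lc nz_c] min_n]] := min_degree Jp0 nz_p0.
have idL : two_sided_ideal (lead_coefs J n) by exact: lead_coefs_ideal.
have Lsigma d : lead_coefs J n d -> lead_coefs J n (sigma d).
  move=> [q [Jq lq <-]]; have [lsq sq_n] := sigma_ext_lead lq.
  (* the coefficient of [sigmaD q] at [n] is off by a unit factor only *)
  have PU := unitr_prod_iter nu n rhoU.
  have [_ _ LM] := idL; rewrite -[sigma _](mulrK PU).
  by apply: (LM _ _ _).2; exists (sigmaD q); split=> //; apply: Jsigma.
case: (simple_sigma idL Lsigma) => [L0|Lfull].
  by case: nz_c; apply/L0.
have [p [Jp lp p_n]] := Lfull 1.
have pE : p = h ^+ n + \sum_(i < n) C (coefs p i) * h ^+ i.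
  by rewrite {1}(skewpolyE_wide lp) big_ord_recr /= p_n rmorph1 mul1r addrC.
have below q : J q -> (ssize q <= n.+1)%N -> coefs q n = 0 -> q = 0.
  move=> Jq lq q_n; apply: min_n => //; apply/ssizeP => i; rewrite leq_eqVlt.
  by case/predU1P => [<- //|lt_ni]; apply: (ssizeP _ _ lq).
have pC d : p * C d = C (iter n nu d) * p.
  apply/eqP; rewrite -subr_eq0; apply/eqP/below.
  - by apply: JD; [exact: (JM _ _ Jp).2 | apply: JN; exact: (JM _ _ Jp).1].
  - apply/ssizeP => i lt_ni; rewrite coefsB coefs_mulC coefs_Cmul.
    by rewrite (ssizeP _ _ lp) // mul0r mulr0 subr0.
  - by rewrite coefsB coefs_mulC coefs_Cmul p_n mul1r mulr1 subrr.
have sp : sigmaD p = C (\prod_(i < n) iter i nu rho) * p.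
  have [lsp sp_n] := sigma_ext_lead lp.
  apply/eqP; rewrite -subr_eq0; apply/eqP/below.
  - by apply: JD; [exact: Jsigma | apply: JN; exact: (JM _ _ Jp).1].
  - apply/ssizeP => i lt_ni; rewrite coefsB coefs_Cmul.
    by rewrite (ssizeP _ _ lp) // (ssizeP _ _ lsp) // mulr0 subr0.
  - by rewrite coefsB coefs_Cmul sp_n p_n rmorph1 mul1r mulr1 subrr.
have hp : h * p - p * h = 0.
  have nuu : nu u = u by apply: (mulIr uU); rewrite nu_u.
  have iter_u k : iter k nu u = u by elim: k => //= k ->.
  (* As nu is conjugation by u, the element z = u^-1 h is central, and h = u z;
     so it is enough that p commutes with u, which is a case of pC. *)
  have uh q : u^-1 * nu q = q * u^-1.
    by apply: (mulIr uU); rewrite -!mulrA nu_u mulVr // mulr1 mulKr.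
  have pu : p * C u = C u * p by rewrite pC iter_u.
  have hE : h = C u * (C u^-1 * h).
    by rewrite mulrA -rmorphM mulrV // rmorph1 mul1r.
  have zh q : (C u^-1 * h) * q = q * (C u^-1 * h).
    have zX k : (C u^-1 * h) * h ^+ k = h ^+ k * (C u^-1 * h).
      have hV : h * C u^-1 = C u^-1 * h.
        rewrite [LHS]skewXC; congr (C _ * _).
        by apply: (mulIr uU); rewrite nu_u mulVr // mulrV.
      by apply: commrX; rewrite /GRing.comm [RHS]mulrA hV.
    have zC d : (C u^-1 * h) * C d = C d * (C u^-1 * h).
      by rewrite -mulrA [h * C d]skewXC mulrA mulrA -!rmorphM uh.
    rewrite [q]skewpolyE mulr_sumr mulr_suml; apply: eq_bigr => i _.
    transitivity (C u^-1 * h * C (coefs q i) * h ^+ i); first exact: mulrA.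
    by rewrite zC -mulrA zX mulrA.
  by rewrite hE -mulrA zh mulrA -pu -mulrA subrr.
case: n pE pC sp lp {Lc idL Lsigma Lfull min_n below} p_n => [|n] pE pC sp _ _.
  by suff <- : p = 1 by []; rewrite pE expr0 big_ord0 addr0.
by case: (no_normal (ltn0Sn n)); exists (fun i => coefs p i), p.
Qed.

End HringIdeals.

(** * Ideals of D[h; nu][X; sigma] *)

Section SkewLaurentIdeals.
Variables (D : unitRingType) (sigma tau : {rmorphism D -> D}) (b rho : D).
Local Notation nu := (nu_endo sigma tau).
Local Notation C := (hC sigma tau).
Local Notation h := (hX sigma tau).
Local Notation sigmaD := (sigma_ext sigma tau b rho).
Hypothesis rhoP : forall d, sigma (tau d) * rho = rho * tau (sigma d).
Hypothesis bP : forall d, sigma (tau d) * b = b * d.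
Hypothesis rhoU : rho \is a GRing.unit.

Definition sigma_rm : {rmorphism hring sigma tau -> hring sigma tau} :=
  HB.pack (sigma_ext sigma tau b rho : hring sigma tau -> hring sigma tau)
    (GRing.isZmodMorphism.Build _ _ _
      (@sigma_ext_is_zmod_morphism D sigma tau b rho))
    (GRing.isMonoidMorphism.Build _ _ _ (sigma_ext_is_monoid_morphism rhoP bP)).

Lemma sigma_ext_surj : (forall d, exists c, sigma c = d) ->
  forall p, exists q, sigmaD q = p.
Proof.
move=> s_surj; pose im p := exists q, sigmaD q = p.
have imM p q : im p -> im q -> im (p * q).
  move=> [p' <-] [q' <-]; exists (p' * q').
  exact: (sigma_ext_is_monoid_morphism rhoP bP).2.
have imC d : im (C d).
  by have [c <-] := s_surj d; exists (C c); rewrite sigma_extC.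
have imD p q : im p -> im q -> im (p + q).
  by move=> [p' <-] [q' <-]; exists (p' + q'); rewrite sigma_extD.
have imX : im h.
  have -> : h = C rho^-1 * (hX' sigma tau b rho + C (- b)).
    by rewrite /hX' rmorphN addrK mulrA -rmorphM mulVr // rmorph1 mul1r.
  apply: (imM _ _) => //; apply: imD => //; exists h; exact: sigma_extX.
exact: skewpoly_ind.
Qed.

(** The constant coefficient of [p] is killed by [c] since [p * h] and [h * p]
    have none, and each further coefficient by induction. *)
Lemma comm_affine_eq0 a c (p : hring sigma tau) :
  c \is a GRing.unit -> p * h = (C a * h + C c) * p -> p = 0.
Proof.
move=> cU Ep; apply: skewpolyP => k; rewrite coef0.
have cp j : coefs (p * h) j = a * coefs (h * p) j + c * coefs p j.
  by rewrite Ep mulrDl coefsD -mulrA !coefs_Cmul.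
apply: (mulrI cU); rewrite mulr0; elim: k => [|k IH].
  by have := cp 0; rewrite coefs_mulX coefs_Xmul mulr0 add0r.
have pk : coefs p k = 0 by apply: (mulrI cU); rewrite IH mulr0.
by have := cp k.+1; rewrite coefs_mulX coefs_Xmul pk rmorph0 mulr0 add0r.
Qed.

Section Saturation.
Variables (R : nzRingType) (s : {rmorphism R -> R}) (I : skewpoly s -> Prop).
Hypotheses (s_surj : forall c, exists d, s d = c) (idealI : two_sided_ideal I).

(** Cancelling powers of the variable on the right makes the set of leading
    coefficients in a fixed degree stable under [s]; see [X_saturation_lead]. *)
Definition X_saturation (F : skewpoly s) := exists N, I (F * skewX s ^+ N).

Lemma X_saturation_ideal : two_sided_ideal X_saturation.
Proof.
have [I0 ID IM] := idealI; split.
- by exists 0; rewrite mul0r.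
- move=> F G [M IF] [N IG]; exists (M + N)%N; rewrite mulrDl; apply: ID.
    by rewrite exprD mulrA; apply: (IM _ _ IF).2.
  by rewrite addnC exprD mulrA; apply: (IM _ _ IG).2.
- move=> G F [N IF]; split.
    by exists N; rewrite -mulrA; apply: (IM _ _ IF).1.
  exists N; suff [G' EG] : exists G', skewX s ^+ N * G' = G * skewX s ^+ N.
    by rewrite -mulrA -EG mulrA; apply: (IM _ _ IF).2.
  have XG H : exists H', skewX s * H' = H * skewX s.
    pose P H := exists H', skewX s * H' = H * skewX s.
    rewrite [H]skewpolyE; apply: (big_ind P).
    + by exists 0; rewrite mulr0 mul0r.
    + move=> G1 G2 [p Ep] [q Eq]; exists (p + q).
      by rewrite mulrDr Ep Eq mulrDl.
    + move=> i _; have [d <-] := s_surj (coefs H i).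
      exists (skewC s d * skewX s ^+ i).
      by rewrite mulrA skewXC -!mulrA -exprS -exprSr.
  elim: N {IF} => [|N [G' EG]]; first by exists G; rewrite mul1r mulr1.
  have [G2 E2] := XG G'; exists G2.
  by rewrite exprSr -mulrA E2 mulrA EG -mulrA.
Qed.

(** If [F] has coefficients [c_i], then [X F = G X] where [G] has coefficients
    [s c_i]; saturation puts [G] back into the ideal, in the same degree. *)
Lemma X_saturation_lead n c :
  lead_coefs X_saturation n c -> lead_coefs X_saturation n (s c).
Proof.
move=> [F [[N IF] lF <-]]; pose G := SkewPoly s (map_poly s (skewcoef F)).
have GE : G * skewX s = skewX s * F.
  by apply: skewpolyP => -[|i]; rewrite coefs_mulX coefs_Xmul //= coef_map.
exists G; rewrite coef_map; split=> //.
  exists N.+1; rewrite exprS mulrA GE -mulrA.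
  by have [_ _ IM] := idealI; apply: (IM _ _ IF).1.
exact: leq_trans (size_poly _ _) lF.
Qed.

End Saturation.

Variable u : D.
Hypotheses (uU : u \is a GRing.unit) (nu_u : forall d, nu d * u = u * d).
Hypothesis sigma_inj : injective sigma.
Hypothesis sigma_surj : forall d, exists c, sigma c = d.
Hypothesis nu_surj : forall d, exists c, nu c = d.
Hypothesis simple_sigma : endo_simple sigma.
Hypothesis no_normal :
  forall n, (0 < n)%N ->
  ~ exists (d_ : 'I_n -> D) p, @normal_poly _ sigma tau b rho n d_ p.
Hypothesis b_unit :
  forall i, (0 < i)%N -> coef_b sigma b rho i \is a GRing.unit.

(** In the saturation of [I] there is a monic [F] of the least degree [n]. The
    element [F h - sigma^n(h) F] has smaller degree, so it is 0; comparing
    coefficients, [F] has no term below [X^n]. *)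
Lemma skew_ideal_Xn (I : skewpoly sigma_rm -> Prop) :
  two_sided_ideal I -> forall F, I F -> F <> 0 ->
  exists N, I (skewX sigma_rm ^+ N).
Proof.
move=> idI F0 IF0 nz_F0; have sD_surj : forall c, exists d, sigma_rm d = c.
  exact: sigma_ext_surj.
have idS := X_saturation_ideal sD_surj idI.
have SF0 : X_saturation I F0 by exists 0; rewrite mulr1.
have [n [[c Lc nz_c] min_n]] := min_degree SF0 nz_F0.
have idL := lead_coefs_ideal idS sD_surj n.
have [] := hring_ideal_full rhoU uU nu_u simple_sigma nu_surj no_normal
  idL (@X_saturation_lead _ _ _ idI n) Lc nz_c.
move=> F [SF lF F_n]; have [_ SD SM] := idS.
pose hn := iter n sigmaD h.
pose G := F * skewC sigma_rm h - skewC sigma_rm hn * F.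
have GE i : coefs G i = coefs F i * iter i sigma_rm h - hn * coefs F i.
  exact: etrans (coefsB _ _ _) (congr2 _ (coefs_mulC _ _ _)
    (congr1 _ (coefs_Cmul _ _ _))).
have G0 : G = 0.
  apply: min_n.
    apply: SD; first exact: (SM _ _ SF).2.
    by rewrite -mulNr; apply: (SM _ _ SF).1.
  apply/ssizeP => i; rewrite GE leq_eqVlt.
  case/predU1P => [<-|lt_ni]; first by rewrite F_n mul1r mulr1 subrr.
  by rewrite (ssizeP _ _ lF) // mul0r mulr0 subrr.
have FE : F = skewX sigma_rm ^+ n.
  apply: skewpolyP => i; rewrite skewXn coef_skewM.
  have [->|ne_in] := eqVneq i n; first exact: F_n.
  have [lt_ni|le_in] := ltnP n i; first by rewrite (ssizeP _ _ lF).
  have {le_in ne_in} lt_in : (i < n)%N by rewrite ltn_neqAle ne_in.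
  have : coefs G i = 0 by rewrite G0 coef0.
  rewrite GE => /eqP; rewrite subr_eq0 /hn.
  (* writing the coefficient as sigma^i(p) turns the relation between
     sigma^i(h) and sigma^n(h) into one between h and sigma^(n-i)(h) *)
  have [p <-] := iter_surj sD_surj i (coefs F i).
  have -> : iter n sigmaD h = iter i sigmaD (iter (n - i) sigmaD h).
    by rewrite -iterD subnKC // ltnW.
  have itM := iter_rmorphM sigma_rm; rewrite -!(itM i) => /eqP.
  have inj_it k : injective (iter k sigmaD).
    by elim: k => //= k IH q r /(sigma_ext_inj rhoU sigma_inj)/IH.
  move/inj_it; rewrite iter_sigma_ext ?subn_gt0 // => /comm_affine_eq0 ->.
    exact: (iter_rmorph0 sigma_rm).
  by apply: b_unit; rewrite subn_gt0.
have [N] := SF; rewrite FE -exprD => I_X.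
by exists (n + N)%N.
Qed.

End SkewLaurentIdeals.

(** * From the criterion to simplicity *)

Section DiskewGenerators.
Variables (D : nzRingType) (sigma tau : D -> D) (b rho : D).
Local Notation E := (diskew sigma tau b rho).
Local Notation x := (diskewX sigma tau b rho).
Local Notation y := (diskewY sigma tau b rho).
Local Notation c := (diskewC sigma tau b rho).

Lemma diskew_lmul_ind (P : E -> Prop) :
  (forall e f, P e -> P f -> P (e + f)) ->
  (forall d e, P e -> P (c d * e)) ->
  (forall e, P e -> P (x * e)) -> (forall e, P e -> P (y * e)) ->
  P 1 -> forall e, P e.
Proof.
move=> PD PC PX PY P1 e; rewrite -[e]mulr1 -[e]dpiK.
elim: (repr e) (1 : E) P1 => {e} [d|||s IH|s IHs t IHt|s IHs t IHt] e Pe.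
- exact: PC.
- exact: PX.
- exact: PY.
- have := IH _ (PC (- 1) _ Pe); rewrite rmorphN rmorph1 mulN1r mulrN -mulNr.
  by rewrite -[- _]dpi_opp.
- by rewrite dpi_add [_ * _]mulrDl; apply: (PD _ _ (IHs _ Pe) (IHt _ Pe)).
- by rewrite dpi_mul -[_ * _]mulrA; apply: IHs; apply: IHt.
Qed.

End DiskewGenerators.

Section DiskewSimple.
Variables (D : unitRingType) (sigma tau : {rmorphism D -> D}) (b rho : D).
Local Notation nu := (nu_endo sigma tau).
Local Notation C := (hC sigma tau).
Local Notation h := (hX sigma tau).
Local Notation sigmaD := (sigma_ext sigma tau b rho).
Local Notation tauD := (tau_ext sigma tau b rho).
Local Notation E := (diskew sigma tau b rho).
Local Notation x := (diskewX sigma tau b rho).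
Local Notation y := (diskewY sigma tau b rho).
Local Notation c := (diskewC sigma tau b rho).
Hypothesis rhoP : forall d, sigma (tau d) * rho = rho * tau (sigma d).
Hypothesis bP : forall d, sigma (tau d) * b = b * d.
Hypothesis rhoU : rho \is a GRing.unit.

Definition inE_rm : {rmorphism hring sigma tau -> E} :=
  HB.pack (hring_inE sigma tau b rho : hring sigma tau -> E)
    (GRing.isZmodMorphism.Build _ _ _
      (@hring_inE_is_zmod_morphism D sigma tau b rho))
    (GRing.isMonoidMorphism.Build _ _ _
      (hring_inE_is_monoid_morphism sigma tau b rho)).

Lemma inE_C d : inE_rm (C d) = c d.
Proof. exact: hring_inEC. Qed.

Lemma inE_h : inE_rm h = y * x.
Proof. exact: hring_inEX. Qed.

Lemma diskewX_inE p : x * inE_rm p = inE_rm (sigmaD p) * x.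
Proof.
elim/skewpoly_ind: p => [p q Ep Eq|p q Ep Eq|d|].
- by rewrite rmorphD mulrDr Ep Eq -mulrDl -rmorphD -sigma_extD.
- by rewrite rmorphM mulrA Ep -mulrA Eq mulrA -rmorphM -sigma_extM.
- by rewrite [in RHS]sigma_extC !inE_C diskewXC.
- rewrite [in RHS]sigma_extX inE_h mulrA.
  by rewrite -[inE_rm _]/(hring_inE sigma tau b rho _) hring_inEX'.
Qed.

Lemma diskewY_inE p : y * inE_rm p = inE_rm (tauD p) * y.
Proof.
elim/skewpoly_ind: p => [p q Ep Eq|p q Ep Eq|d|].
- by rewrite rmorphD mulrDr Ep Eq -mulrDl -rmorphD -tau_extD.
- by rewrite rmorphM mulrA Ep -mulrA Eq mulrA -rmorphM -tau_extM.
- by rewrite [in RHS]tau_extC !inE_C diskewYC.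
have xyE : x * y = c rho * (y * x) + c b.
  by rewrite -[c b]diskewXY mulrA addrC subrK.
have yxy : y * x * y = c (tau rho) * y * (y * x) + c (tau b) * y.
  by rewrite -mulrA xyE mulrDr mulrA !diskewYC.
rewrite [in RHS]tau_extX rmorphM rmorphB !inE_C inE_h -mulrA mulrBl yxy addrK.
by rewrite !mulrA -!rmorphM mulVr // !rmorph1 mul1r.
Qed.

Local Notation ev := (@skew_eval _ (sigma_rm rhoP bP) E inE_rm x).
Local Notation evy := (@skew_eval _ (sigma_rm rhoP bP) E inE_rm y).
Local Notation skewpolyX := (skewpoly (sigma_rm rhoP bP)).

(** The powers of [y] start at [y^1], so that no monomial is counted twice; the
    polynomial [G] only serves as a family of coefficients. *)
Lemma diskew_span e : exists F G : skewpolyX, e = ev F + evy G * y.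
Proof.
pose S e := exists F G : skewpolyX, e = ev F + evy G * y.
have SD e1 e2 : S e1 -> S e2 -> S (e1 + e2).
  move=> [F1 [G1 ->]] [F2 [G2 ->]]; exists (F1 + F2), (G1 + G2).
  by rewrite !skew_evalD mulrDl addrACA.
have S0 : S 0 by exists 0, 0; rewrite !skew_eval0 mul0r addr0.
have Sx p i : S (inE_rm p * x ^+ i).
  by exists (skewM _ p i), 0; rewrite skew_evalM1 skew_eval0 mul0r addr0.
have Sy p j : S (inE_rm p * y ^+ j).
  case: j => [|j]; first exact: (Sx p 0).
  by exists 0, (skewM _ p j); rewrite skew_evalM1 skew_eval0 add0r exprSr mulrA.
have lmul a : (forall p i, S (a * (inE_rm p * x ^+ i))) ->
    (forall p j, S (a * (inE_rm p * y ^+ j.+1))) -> forall e, S e -> S (a * e).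
  move=> ax ay e1 [F [G ->]]; rewrite mulrDr; apply: (SD _ _).
    by rewrite mulr_sumr; apply: (big_ind S) => // i _; apply: ax.
  rewrite mulr_suml mulr_sumr; apply: (big_ind S) => // j _.
  by rewrite -[_ * _ * y]mulrA -exprSr; apply: ay.
move: e; apply: (@diskew_lmul_ind _ _ _ _ _ S SD) => [d|||].
- apply: lmul => p i; rewrite mulrA -inE_C -rmorphM; [exact: Sx | exact: Sy].
- apply: lmul => p i; rewrite mulrA diskewX_inE -mulrA; first by rewrite -exprS.
  rewrite exprS [x * _]mulrA -[x * y](hring_inEX' sigma tau) mulrA.
  by rewrite -[hring_inE _ _ _ _ _]/(inE_rm _) -rmorphM.
- apply: lmul => p i; rewrite mulrA diskewY_inE -mulrA; last by rewrite -exprS.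
  case: i => [|i]; first by rewrite mulr1; apply: (Sy _ 1%N).
  by rewrite exprS [y * _]mulrA -inE_h mulrA -rmorphM.
- by have := Sx 1 0%N; rewrite rmorph1 mulr1.
Qed.

(** The element of D[h; nu] equal to [y^j x^j] in E. *)
Fixpoint clear_y j : hring sigma tau :=
  if j is k.+1 then tauD (clear_y k) * h else 1.

Lemma clear_yE j : y ^+ j * x ^+ j = inE_rm (clear_y j).
Proof.
elim: j => [|j IH]; first by rewrite mulr1 [RHS]rmorph1.
rewrite exprS exprSr mulrA -[y * _ * _]mulrA IH diskewY_inE -mulrA -inE_h.
by rewrite -rmorphM.
Qed.

Lemma clear_y_lead j : (ssize (clear_y j) <= j.+1)%N /\
  coefs (clear_y j) j \is a GRing.unit.
Proof.
elim: j => [|j [lw wU]]; first by rewrite /= coef1 size_poly1 unitr1.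
pose v := C (tau rho^-1) * (h - C (tau b)).
have size_v : (ssize v <= 2)%N.
  apply/ssizeP => -[|[|i]] // _.
  by rewrite coefs_Cmul coefsB /= coefX coefC subr0 mulr0.
have v1 : coefs v 1 = tau rho^-1.
  by rewrite coefs_Cmul coefsB /= coefX coefC subr0 mulr1.
have [lt tU] := skew_eval_lead tau size_v lw; split.
  apply/ssizeP => -[|i] // lt_ji; rewrite [LHS]coefs_mulX.
  by apply: (ssizeP _ _ lt).
rewrite [coefs _ _]coefs_mulX tU v1 rpredM ?rmorph_unit //.
by apply: unitr_prod_iter; rewrite rmorph_unit ?unitrV.
Qed.

(** Multiplication by [x^N] turns the term [q y^(j+1)] into
    [q (y^(j+1) x^(j+1)) x^(N-j-1)], a power of [x] with coefficient
    [q * clear_y j.+1]. This is nonzero with [q], since the leading coefficient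
    of [clear_y] is a unit; and distinct terms go to distinct powers. So a
    nonzero [e] gives a nonzero [F]. *)
Lemma clear_denominator e : e <> 0 ->
  exists N (F : skewpolyX), F <> 0 /\ ev F = e * x ^+ N.
Proof.
have [F [G ->]] := diskew_span e; set N := ssize G => nz_e.
pose A j := skewM (sigma_rm rhoP bP) (coefs G j * clear_y j.+1) (N - j.+1).
exists N, (F * skewX _ ^+ N + \sum_(j < N) A j).
have evM := @skew_evalM _ (sigma_rm rhoP bP) _ inE_rm x diskewX_inE.
split; last first.
  rewrite skew_evalD skew_eval_sum evM.
  have evX k : ev (skewX _ ^+ k) = x ^+ k.
    by rewrite skewXn skew_evalM1 rmorph1 mul1r.
  rewrite evX mulrDl; congr (_ + _); rewrite !mulr_suml; apply: eq_bigr => j _.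
  rewrite skew_evalM1 rmorphM -clear_yE -!mulrA -exprD subnKC //.
  by rewrite [y ^+ j.+1]exprSr -!mulrA.
move=> FA0; apply: nz_e.
have G0 : G = 0.
  apply: skewpolyP => j; rewrite coef0; have [lt_jN|] := ltnP j N; last first.
    by move=> le_Nj; rewrite nth_default.
  have [lw wU] := clear_y_lead j.+1; apply: (mulr_lead_unit_eq0 lw wU).
  have : coefs (F * skewX _ ^+ N + \sum_(j < N) A j) (N - j.+1) = 0.
    by rewrite FA0 coef0.
  rewrite coefsD coefs_mulXn coefs_sum.
  rewrite (_ : (N - j.+1 < N)%N = true) ?add0r; last by lia.
  rewrite (bigD1 (Ordinal lt_jN)) // big1 => [|k ne_kj].
    by rewrite coef_skewM eqxx /= addr0.
  rewrite coef_skewM; case: eqP => // E; case/eqP: ne_kj.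
  by apply: val_inj => /=; move: (ltn_ord k); lia.
have F0 : F = 0.
  have N0 : N = 0%N by rewrite /N G0 size_poly0.
  apply: skewpolyP => i.
  have : coefs (F * skewX _ ^+ N + \sum_(j < N) A j) i = 0.
    by rewrite FA0 coef0.
  by rewrite N0 big_ord0 addr0 mulr1 => ->; rewrite coef0.
by rewrite F0 G0 !skew_eval0 mul0r addr0.
Qed.

Variable u : D.
Hypotheses (uU : u \is a GRing.unit) (nu_u : forall d, nu d * u = u * d).
Hypothesis sigma_inj : injective sigma.
Hypothesis sigma_surj : forall d, exists c, sigma c = d.
Hypothesis nu_surj : forall d, exists c, nu c = d.
Hypothesis simple_sigma : endo_simple sigma.
Hypothesis no_normal :
  forall n, (0 < n)%N ->
  ~ exists (d_ : 'I_n -> D) p, @normal_poly _ sigma tau b rho n d_ p.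
Hypothesis b_unit :
  forall i, (0 < i)%N -> coef_b sigma b rho i \is a GRing.unit.

Lemma diskew_neq0 : (1 : E) <> 0.
Proof.
rewrite -(rmorph1 inE_rm) -(rmorph0 inE_rm) => /(hring_inE_inj rhoP bP rhoU).
exact/eqP/oner_neq0.
Qed.

(** [x^k y - a_k y x^k = b_k x^(k-1)] with [k = n + 1], and [b_k] is a unit. *)
Lemma diskew_ideal_X_lower (I : E -> Prop) n :
  two_sided_ideal I -> I (x ^+ n.+1) -> I (x ^+ n).
Proof.
move=> [I0 ID IM] Ix; have IN e : I e -> I (- e).
  by move=> Ie; rewrite -mulN1r; apply: (IM _ _ Ie).1.
have xy : x ^+ n.+1 * y = inE_rm (iter n.+1 sigmaD h) * x ^+ n.
  rewrite exprSr -mulrA -[x * y](hring_inEX' sigma tau) iterSr sigma_extX.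
  rewrite -[hring_inE _ _ _ _ _]/(inE_rm _).
  exact: (@skew_eval_twist _ (sigma_rm rhoP bP) _ inE_rm x diskewX_inE).
have bx : I (c (coef_b sigma b rho n.+1) * x ^+ n).
  have -> : c (coef_b sigma b rho n.+1) * x ^+ n =
    x ^+ n.+1 * y - c (coef_a sigma rho n.+1) * y * x ^+ n.+1.
    rewrite xy iter_sigma_ext // [inE_rm _]rmorphD rmorphM !inE_C inE_h mulrDl.
    by rewrite exprS !mulrA addrAC subrr add0r.
  by apply: ID; [exact: (IM _ _ Ix).2 | apply: IN; exact: (IM _ _ Ix).1].
have := (IM (c (coef_b sigma b rho n.+1)^-1) _ bx).1.
by rewrite mulrA -rmorphM mulVr ?b_unit // rmorph1 mul1r.
Qed.

Lemma diskew_simple : simple_ring E.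
Proof.
split=> [|I idI]; first exact: diskew_neq0.
have [I0 ID IM] := idI.
have [[e Ie nz_e]|no_e] := pselect (exists2 e, I e & e <> 0); last first.
  left=> e; split=> [Ie|-> //]; apply: contrapT => nz_e.
  by apply: no_e; exists e.
have evM := @skew_evalM _ (sigma_rm rhoP bP) _ inE_rm x diskewX_inE.
have [N [F [nz_F evF]]] := clear_denominator nz_e.
have idI' : two_sided_ideal (fun F : skewpolyX => I (ev F)).
  split; first by rewrite skew_eval0.
    by move=> G1 G2 IG1 IG2; rewrite skew_evalD; apply: ID.
  by move=> A G IG; rewrite !evM; apply: IM.
have I'F : I (ev F) by rewrite evF; apply: (IM _ _ Ie).2.
have [n] := skew_ideal_Xn rhoU uU nu_u sigma_inj sigma_surj nu_surj simple_sigma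
  no_normal b_unit idI' I'F nz_F.
rewrite skewXn skew_evalM1 rmorph1 mul1r => Ixn.
have I1 : I 1 by elim: n Ixn => // n IH /(diskew_ideal_X_lower idI)/IH.
by right=> f; rewrite -[f]mulr1; apply: (IM _ _ I1).1.
Qed.

End DiskewSimple.

(** * Modules over E *)

Section Modules.
Variables (D : nzRingType) (sigma tau : D -> D) (b rho : D).
Local Notation E := (diskew sigma tau b rho).
Local Notation x := (diskewX sigma tau b rho).
Local Notation y := (diskewY sigma tau b rho).
Local Notation c := (diskewC sigma tau b rho).

(** These are the defining relations of E, read as identities between operators
    on [V]; so [V] becomes a left E-module. *)
Record diskew_module (V : zmodType) (fd : D -> V -> V) (fx fy : V -> V) :
    Prop :=
  DiskewModule {
    mod_dDr : forall d v w, fd d (v + w) = fd d v + fd d w;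
    mod_dDl : forall d e v, fd (d + e) v = fd d v + fd e v;
    mod_dM : forall d e v, fd (d * e) v = fd d (fd e v);
    mod_d1 : forall v, fd 1 v = v;
    mod_xD : forall v w, fx (v + w) = fx v + fx w;
    mod_yD : forall v w, fy (v + w) = fy v + fy w;
    mod_xd : forall d v, fx (fd d v) = fd (sigma d) (fx v);
    mod_yd : forall d v, fy (fd d v) = fd (tau d) (fy v);
    mod_xy : forall v, fx (fy v) - fd rho (fy (fx v)) = fd b v }.

Section Action.
Variables (V : zmodType) (fd : D -> V -> V) (fx fy : V -> V).
Hypothesis modV : diskew_module fd fx fy.

Fixpoint term_act (t : dterm D) (v : V) : V :=
  match t with
  | DCoef d => fd d v
  | DX => fx v
  | DY => fy v
  | DOpp s => - term_act s v
  | DAdd s s' => term_act s v + term_act s' v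
  | DMul s s' => term_act s (term_act s' v)
  end.

Lemma mod_0d v : fd 0 v = 0.
Proof. by apply: (addIr (fd 0 v)); rewrite -(mod_dDl modV) !add0r. Qed.

Lemma term_actD t v w : term_act t (v + w) = term_act t v + term_act t w.
Proof.
elim: t v w => [d|||s IH|s IH s' IH'|s IH s' IH'] v w /=.
- exact: mod_dDr modV _ _ _.
- exact: mod_xD modV _ _.
- exact: mod_yD modV _ _.
- by rewrite IH opprD.
- by rewrite IH IH' addrACA.
- by rewrite IH' IH.
Qed.

Lemma term_act_cong s t : dcong sigma tau b rho s t -> term_act s =1 term_act t.
Proof.
elim=> {s t} /=.
- by [].
- by move=> s t _ IH v; rewrite IH.
- by move=> s t w _ IH _ IH' v; rewrite IH.
- by move=> s s' _ IH v /=; rewrite IH.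
- by move=> s s' t t' _ IH _ IH' v /=; rewrite IH IH'.
- by move=> s s' t t' _ IH _ IH' v /=; rewrite IH' IH.
- by move=> s t w v /=; rewrite addrA.
- by move=> s t v /=; rewrite addrC.
- by move=> s v /=; rewrite mod_0d add0r.
- by move=> s v /=; rewrite addNr mod_0d.
- by [].
- by move=> s v /=; rewrite (mod_d1 modV).
- by move=> s v /=; rewrite (mod_d1 modV).
- by [].
- by move=> s t w v /=; rewrite term_actD.
- by move=> d e v /=; rewrite (mod_dDl modV).
- by move=> d e v /=; rewrite (mod_dM modV).
- by move=> d v /=; rewrite (mod_xd modV).
- by move=> d v /=; rewrite (mod_yd modV).
- by move=> v /=; rewrite (mod_xy modV).
Qed.

Definition mod_act (e : E) : V -> V := term_act (repr e).

Lemma mod_act_dpi s v : mod_act (dpi sigma tau b rho s) v = term_act s v.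
Proof. by apply: term_act_cong; apply: dcong_repr. Qed.

Lemma mod_actC d v : mod_act (c d) v = fd d v.
Proof. exact: mod_act_dpi. Qed.

Lemma mod_actX v : mod_act x v = fx v.
Proof. exact: mod_act_dpi. Qed.

Lemma mod_actY v : mod_act y v = fy v.
Proof. exact: mod_act_dpi. Qed.

Lemma mod_actDl e f v : mod_act (e + f) v = mod_act e v + mod_act f v.
Proof.
by rewrite -[e]dpiK -[f]dpiK -[_ + _]dpi_add !mod_act_dpi.
Qed.

Lemma mod_actM e f v : mod_act (e * f) v = mod_act e (mod_act f v).
Proof.
rewrite -[e]dpiK -[f]dpiK -[_ * _]dpi_mul !mod_act_dpi.
by [].
Qed.

Lemma mod_act0 v : mod_act 0 v = 0.
Proof. by rewrite -[0]/(c 0) mod_actC mod_0d. Qed.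

Lemma mod_act1 v : mod_act 1 v = v.
Proof. by rewrite -[1]/(c 1) mod_actC (mod_d1 modV). Qed.

(** The elements of E sending [V] into a submodule [N] form a two-sided ideal;
    it is nonzero, so it contains 1. *)
Lemma simple_submodule_full (N : V -> Prop) (e : E) :
  simple_ring E ->
  N 0 -> (forall v w, N v -> N w -> N (v + w)) ->
  (forall d v, N v -> N (fd d v)) ->
  (forall v, N v -> N (fx v)) -> (forall v, N v -> N (fy v)) ->
  e <> 0 -> (forall v, N (mod_act e v)) -> forall v, N v.
Proof.
move=> [_ simpleE] N0 ND Nd Nx Ny nz_e Ne.
have Nact f v : N v -> N (mod_act f v).
  move: f v; apply: diskew_lmul_ind.
  - move=> f g Nf Ng v Nv; rewrite mod_actDl.
    by apply: ND; [exact: Nf | exact: Ng].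
  - by move=> d f Nf v Nv; rewrite mod_actM mod_actC; apply/Nd/Nf.
  - by move=> f Nf v Nv; rewrite mod_actM mod_actX; apply/Nx/Nf.
  - by move=> f Nf v Nv; rewrite mod_actM mod_actY; apply/Ny/Nf.
  - by move=> v; rewrite mod_act1.
pose I f := forall v, N (mod_act f v).
have idI : two_sided_ideal I.
  split.
  - by move=> v; rewrite mod_act0.
  - move=> f g If Ig v; rewrite mod_actDl.
    by apply: ND; [exact: If | exact: Ig].
  - move=> a f If; split=> v; rewrite mod_actM; [exact/Nact/If | exact: If].
case: (simpleE I idI) => [I0|I1]; first by case: nz_e; apply/I0.
by move=> v; rewrite -[v]mod_act1; apply: I1.
Qed.

End Action.
End Modules.

(** * Consequences of simplicity *)

Lemma rmorph_inj0 (R S : pzRingType) (f : {rmorphism R -> S}) :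
  (forall d, f d = 0 -> d = 0) -> injective f.
Proof.
move=> ker0 p q /eqP; rewrite -subr_eq0 -rmorphB => /eqP/ker0/eqP.
by rewrite subr_eq0 => /eqP.
Qed.

Section SimpleImplies.
Variables (D : unitRingType) (sigma tau : {rmorphism D -> D}) (b rho : D).
Local Notation nu := (nu_endo sigma tau).
Local Notation mu := (mu_endo sigma tau).
Local Notation C := (hC sigma tau).
Local Notation h := (hX sigma tau).
Local Notation sigmaD := (sigma_ext sigma tau b rho).
Local Notation tauD := (tau_ext sigma tau b rho).
Local Notation E := (diskew sigma tau b rho).
Local Notation y := (diskewY sigma tau b rho).
Local Notation c := (diskewC sigma tau b rho).
Hypothesis rhoP : forall d, sigma (tau d) * rho = rho * tau (sigma d).
Hypothesis bP : forall d, sigma (tau d) * b = b * d.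
Hypothesis rhoU : rho \is a GRing.unit.

(** The module is E/E(x-1), with D[h; nu] generated by the image of 1. *)
Lemma hring_module : diskew_module sigma tau b rho
  (fun d (p : hring sigma tau) => C d * p) sigmaD (fun p => tauD p * h).
Proof.
split.
- by move=> d p q; rewrite mulrDr.
- by move=> d e p; rewrite rmorphD mulrDl.
- by move=> d e p; rewrite rmorphM mulrA.
- by move=> p; rewrite rmorph1 mul1r.
- exact: sigma_extD.
- by move=> p q; rewrite tau_extD mulrDl.
- by move=> d p; rewrite sigma_extM // sigma_extC.
- by move=> d p; rewrite tau_extM // tau_extC mulrA.
- move=> p; rewrite sigma_extM // sigma_extX sigma_tau_ext // tau_sigma_ext //.
  by rewrite mulrA -mulrBl /hX' addrC addKr.
Qed.

Local Notation act := (mod_act (fun d (p : hring sigma tau) => C d * p) sigmaD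
  (fun p => tauD p * h)).

Lemma act_inE p q : act (inE_rm sigma tau b rho p) q = p * q.
Proof.
have actM := mod_actM hring_module.
elim/skewpoly_ind: p q => [p1 p2 E1 E2|p1 p2 E1 E2|d|] q.
- by rewrite rmorphD (mod_actDl hring_module) E1 E2 mulrDl.
- by rewrite rmorphM actM E2 E1 mulrA.
- by rewrite inE_C (mod_actC hring_module).
- rewrite inE_h actM (mod_actX hring_module) (mod_actY hring_module).
  exact: tau_sigma_ext.
Qed.

Lemma inE_neq0 p : p <> 0 -> inE_rm sigma tau b rho p <> 0.
Proof.
move=> nz_p p0; apply: nz_p.
by rewrite -[p]mulr1 -act_inE p0 (mod_act0 hring_module).
Qed.

Lemma ideal_coefs_mul (K : D -> Prop) (idK : two_sided_ideal K)
    (p q : hring sigma tau) :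
  (forall i, K (coefs p i)) -> forall i, K (coefs (p * q) i).
Proof.
have [K0 KD KM] := idK; move=> Kp i; rewrite coef_skew_mul.
by apply: (big_ind K) => // j _; apply: (KM _ _ _).2.
Qed.

Lemma ideal_coefs_eval (K : D -> Prop) (idK : two_sided_ideal K)
    (f : {rmorphism D -> D}) (u p : hring sigma tau) :
  (forall d, K d -> K (f d)) ->
  (forall i, K (coefs p i)) -> forall i, K (coefs (skew_eval (C \o f) u p) i).
Proof.
have [K0 KD KM] := idK; move=> Kf Kp i; rewrite coefs_sum.
apply: (big_ind K) => // j _; rewrite coefs_Cmul.
by apply: (KM _ _ _).2; apply: Kf.
Qed.

Hypothesis simpleE : simple_ring E.

(** The polynomials with coefficients in [K] form a submodule of D[h; nu] that
    contains the image of every element of [K]. *)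
Lemma stable_ideal_trivial (K : D -> Prop) :
  two_sided_ideal K -> (forall d, K d -> K (sigma d)) ->
  (forall d, K d -> K (tau d)) -> zero_or_full K.
Proof.
move=> idK Ks Kt; have [K0 KD KM] := idK.
have [[k Kk nz_k]|no_k] := pselect (exists2 k, K k & k <> 0); last first.
  left=> d; split=> [Kd|-> //]; apply: contrapT => nz_d.
  by apply: no_k; exists d.
pose N (p : hring sigma tau) := forall i, K (coefs p i).
have N1 : N 1.
  apply: (simple_submodule_full hring_module simpleE (N := N)
            (e := inE_rm sigma tau b rho (C k))).
  - by move=> i; rewrite coef0.
  - by move=> p q Np Nq i; rewrite coefsD; apply: KD.
  - by move=> d p Np i; rewrite coefs_Cmul; apply: (KM _ _ _).1.
  - by move=> p Np; apply: ideal_coefs_eval.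
  - by move=> p Np; apply: ideal_coefs_mul => //; apply: ideal_coefs_eval.
  - apply: inE_neq0 => Ck0; apply: nz_k.
    have : coefs (C k) 0 = 0 by rewrite Ck0 coef0.
    by rewrite coefC.
  - by move=> p i; rewrite act_inE coefs_Cmul; apply: (KM _ _ _).2.
have K1 : K 1 by have := N1 0%N; rewrite coef1.
by right=> d; rewrite -[d]mulr1; apply: (KM _ _ _).1.
Qed.

(** As [sigma] and [tau] multiply [p] on the left by units of [D], and [p]
    commutes with [h], the left multiples of [p] form a submodule of D[h; nu].
    It contains the image of [p] but not 1, for reasons of degree. *)
Lemma no_normal_poly n : (0 < n)%N ->
  ~ exists (d_ : 'I_n -> D) p, @normal_poly _ sigma tau b rho n d_ p.
Proof.
move=> n_gt0 [d_ [p [pE pC sp hp]]].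
set r := \prod_(i < n) iter i nu rho in sp.
have rU : r \is a GRing.unit by apply: unitr_prod_iter.
have {}hp : h * p = p * h by apply/eqP; rewrite -subr_eq0 hp.
have p_ge k : (n <= k)%N -> coefs p k = (k == n)%:R.
  move=> le_nk; rewrite pE coefsD coefs_sum big1 => [|i _].
    by rewrite addr0 [h]/(skewX nu) skewXn coef_skewM.
  rewrite coefs_Cmul [h]/(skewX nu) skewXn coef_skewM gtn_eqF ?mulr0 //.
  exact: leq_trans (ltn_ord i) le_nk.
have lp : (ssize p <= n.+1)%N.
  by apply/ssizeP => k lt_nk; rewrite p_ge 1?ltnW // gtn_eqF.
(* tau sigma is conjugation by h, which fixes p *)
have tp : tauD p = C (tau r)^-1 * p.
  have trU : tau r \is a GRing.unit by rewrite rmorph_unit.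
  have : tauD (sigmaD p) = p.
    have Eh : tauD (sigmaD p) * h = p * h by rewrite tau_sigma_ext.
    apply: skewpolyP => i.
    have := congr1 (fun q : hring sigma tau => coefs q i.+1) Eh.
    by rewrite !coefs_mulX.
  rewrite sp tau_extM // tau_extC => Ep.
  by rewrite -[in RHS]Ep mulrA -rmorphM mulVr // rmorph1 mul1r.
pose N (q : hring sigma tau) := exists r, q = r * p.
have pN q : N (p * q).
  elim/skewpoly_ind: q => [q1 q2 [r1 E1] [r2 E2]|q1 q2 [r1 E1] [r2 E2]|d|].
  - by exists (r1 + r2); rewrite mulrDr E1 E2 mulrDl.
  - by exists (r1 * r2); rewrite mulrA E1 -mulrA E2 mulrA.
  - by exists (C (iter n nu d)); apply: pC.
  - by exists h; rewrite hp.
have [q Eq] : N 1.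
  apply: (simple_submodule_full hring_module simpleE (N := N)
            (e := inE_rm sigma tau b rho p)).
  - by exists 0; rewrite mul0r.
  - by move=> _ _ [r1 ->] [r2 ->]; exists (r1 + r2); rewrite mulrDl.
  - by move=> d _ [r1 ->]; exists (C d * r1); rewrite mulrA.
  - move=> _ [r1 ->]; exists (sigmaD r1 * C r).
    by rewrite sigma_extM // sp mulrA.
  - move=> _ [r1 ->]; exists (tauD r1 * C (tau r)^-1 * h).
    by rewrite tau_extM // tp -!mulrA hp.
  - apply: inE_neq0 => p0; have := p_ge n (leqnn n).
    by rewrite p0 coef0 eqxx => /esym/eqP; rewrite oner_eq0.
  - by move=> q; rewrite act_inE.
have q0 : q = 0.
  apply: ssize_ind => m lqm.
  have [_] := coefs_mul_lead lqm lp; rewrite -Eq coef1 p_ge // eqxx.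
  by rewrite iter_rmorph1 mulr1 => <-; rewrite gtn_eqF // ltn_addl.
by move/eqP: Eq; rewrite q0 mul0r oner_eq0.
Qed.

Hypothesis nu_surj : forall d, exists c, nu c = d.

Lemma sigma_iter_nu n d : sigma (iter n nu d) = iter n mu (sigma d).
Proof. by elim: n => //= n ->. Qed.

Lemma tau_iter_mu n d : tau (iter n mu d) = iter n nu (tau d).
Proof. by elim: n => //= n ->. Qed.

Lemma muE d : mu d = rho * nu d * rho^-1.
Proof. by apply: (mulIr rhoU); rewrite mulrVK // -rhoP. Qed.

Lemma iter_mu_eq0 n d : iter n mu d = 0 <-> iter n nu d = 0.
Proof.
elim: n d => // n IH d; rewrite !iterSr -IH muE !(iter_rmorphM mu).
have rU : iter n mu rho \is a GRing.unit by rewrite unitr_iter.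
have rVU : iter n mu rho^-1 \is a GRing.unit by rewrite unitr_iter ?unitrV.
split=> [E0|->]; last by rewrite mulr0 mul0r.
by apply: (mulrI rU); apply: (mulIr rVU); rewrite E0 mulr0 mul0r.
Qed.

Lemma tau_surj d : exists e, tau e = d.
Proof. by have [e <-] := nu_surj d; exists (sigma e). Qed.

Lemma mu_surj d : exists e, mu e = d.
Proof.
have [e Ee] := nu_surj (rho^-1 * d * rho); exists e.
by rewrite muE Ee !mulrA mulrV // mul1r mulrK.
Qed.

Lemma sigma_surj d : exists e, sigma e = d.
Proof. by have [e <-] := mu_surj d; exists (tau e). Qed.

(** The union of the kernels of the powers of [nu] is a proper ideal, stable
    under [sigma] and [tau] because [mu] has the same kernels. *)
Lemma nu_ker d : nu d = 0 -> d = 0.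
Proof.
pose K d := exists n, iter n nu d = 0.
have idK : two_sided_ideal K.
  split; first by exists 0.
    move=> d1 d2 [m E1] [n E2]; exists (m + n)%N; rewrite (iter_rmorphD nu).
    by rewrite {1}addnC !iterD E1 E2 !(iter_rmorph0 nu) addr0.
  move=> a e [n En]; split; exists n;
    by rewrite (iter_rmorphM nu) En ?mulr0 ?mul0r.
have Ks e : K e -> K (sigma e).
  case=> n En; exists n; apply/iter_mu_eq0.
  by rewrite -sigma_iter_nu En rmorph0.
have Kt e : K e -> K (tau e).
  by case=> n /iter_mu_eq0 En; exists n; rewrite -tau_iter_mu En rmorph0.
move=> nd0; case: (stable_ideal_trivial idK Ks Kt) => [K0|Kfull].
  by apply/K0; exists 1%N.
have [n /eqP] := Kfull 1; by rewrite (iter_rmorph1 nu) oner_eq0.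
Qed.

Lemma sigma_inj : injective sigma.
Proof.
by apply: rmorph_inj0 => d sd0; apply: nu_ker; rewrite /= sd0 rmorph0.
Qed.

Lemma tau_inj : injective tau.
Proof.
apply: rmorph_inj0 => d td0; apply: nu_ker.
by apply/(iter_mu_eq0 1 d); rewrite /= td0 rmorph0.
Qed.

(** If [v] generates E/Ex, then [x y^j v = beta j y^(j-1) v]. *)
Fixpoint beta j : D := if j is k.+1 then rho * tau (beta k) + b else 0.

Lemma beta_comm j d : beta j * d = mu d * beta j.
Proof.
elim: j d => [|j IH] d; first by rewrite mul0r mulr0.
have [e <-] := tau_surj d.
rewrite /= mulrDl -bP -mulrA -rmorphM IH rmorphM mulrA.
by rewrite -[rho * tau (mu e)](rhoP (tau e)) -mulrA -mulrDr.
Qed.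

Lemma tau_beta_comm j d : tau (beta j) * d = nu d * tau (beta j).
Proof.
by have [e <-] := tau_surj d; rewrite -rmorphM beta_comm rmorphM.
Qed.

Definition low_x (p : {poly D}) :=
  \poly_(j < size p) (sigma p`_j.+1 * beta j.+1).
Definition low_y (p : {poly D}) := 'X * map_poly tau p.

Lemma coef_low_x p j : (low_x p)`_j = sigma p`_j.+1 * beta j.+1.
Proof.
rewrite coef_poly; case: ltnP => // le_pj.
by rewrite nth_default 1?ltnW // rmorph0 mul0r.
Qed.

Lemma coef_low_y p j : (low_y p)`_j = if j is k.+1 then tau p`_k else 0.
Proof. by rewrite coefXM; case: j => //= k; rewrite coef_map. Qed.

(** The module E/Ex: the element [\sum_j c_j y^j v] is stored as the polynomial
    with coefficients [c_j]. *)
Lemma lowest_weight_module : diskew_module sigma tau b rho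
  (fun d (p : {poly D}) => d%:P * p) low_x low_y.
Proof.
split.
- by move=> d p q; rewrite mulrDr.
- by move=> d e p; rewrite polyCD mulrDl.
- by move=> d e p; rewrite polyCM mulrA.
- by move=> p; rewrite mul1r.
- move=> p q; apply/polyP => j.
  by rewrite coefD !coef_low_x coefD rmorphD mulrDl.
- by move=> p q; rewrite /low_y rmorphD mulrDr.
- move=> d p; apply/polyP => j.
  by rewrite coefCM !coef_low_x coefCM rmorphM mulrA.
- move=> d p; apply/polyP => j; rewrite coefCM !coef_low_y.
  by case: j => [|j]; rewrite ?mulr0 // coefCM rmorphM.
- move=> p; apply/polyP => j; rewrite coefB !coefCM coef_low_x !coef_low_y -bP.
  case: j => [|j]; first by rewrite /= rmorph0 !mulr0 add0r subr0.
  rewrite coef_low_x rmorphM mulrA -rhoP -mulrA -mulrBr; congr (_ * _).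
  by rewrite [beta j.+2]/(rho * tau (beta j.+1) + b) addrC addKr.
Qed.

(** As [x y^(m+1) v = beta_(m+1) y^m v], the condition [N] that the coefficients
    of the [y^j v] with [j <= m] lie in the ideal [beta_(m+1) D], after the
    power of [tau] that carries index [j] to index [m], defines a submodule. It
    contains the image of [y^(m+1)], so it contains [y^m v]; that is,
    [beta_(m+1) D] contains 1. *)
Lemma beta_unit m : beta m.+1 \is a GRing.unit.
Proof.
pose N (p : {poly D}) := forall j, (j <= m)%N ->
  exists e, iter (m - j) tau p`_j = beta m.+1 * e.
have Nl d e : exists e', d * (beta m.+1 * e) = beta m.+1 * e'.
  by have [d' <-] := mu_surj d; exists (d' * e); rewrite mulrA -beta_comm mulrA.
have actM := mod_actM lowest_weight_module.
have actY n p :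
    mod_act (fun d (p : {poly D}) => d%:P * p) low_x low_y (y ^+ n) p
    = iter n low_y p.
  elim: n => [|n IH]; first by rewrite (mod_act1 lowest_weight_module).
  by rewrite exprS actM IH (mod_actY lowest_weight_module).
have iterY n p j :
    (iter n low_y p)`_j = if (j < n)%N then 0 else iter n tau p`_(j - n).
  elim: n j => [|n IH] j; first by rewrite subn0.
  rewrite iterS coef_low_y; case: j => // j; rewrite IH ltnS subSS.
  by case: ifP => // _; rewrite rmorph0.
have NX : N 'X^m.
  apply: (simple_submodule_full lowest_weight_module simpleE (N := N)
            (e := y ^+ m.+1)).
  - by move=> j _; exists 0; rewrite coef0 iter_rmorph0 mulr0.
  - move=> p q Np Nq j le_jm.
    have [e1 E1] := Np j le_jm; have [e2 E2] := Nq j le_jm.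
    by exists (e1 + e2); rewrite coefD iter_rmorphD E1 E2 mulrDr.
  - move=> d p Np j le_jm; have [e E1] := Np j le_jm.
    by rewrite coefCM iter_rmorphM E1; apply: Nl.
  - move=> p Np j le_jm; rewrite coef_low_x; have [Ejm|ne_jm] := eqVneq j m.
      rewrite Ejm subnn; have [e <-] := mu_surj (sigma p`_m.+1).
      by exists e; apply/esym/beta_comm.
    have lt_jm : (j < m)%N by rewrite ltn_neqAle ne_jm.
    have [e E1] := Np j.+1 lt_jm; rewrite -(subnSK lt_jm) iterSr rmorphM.
    rewrite -[tau (sigma _)]/(nu _) -tau_beta_comm iter_rmorphM E1.
    exact: Nl.
  - move=> p Np [|j] lt_jm; rewrite coef_low_y.
      by exists 0; rewrite iter_rmorph0 mulr0.
    by rewrite -iterSr subnSK //; apply: Np; apply: ltnW.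
  - move=> y0; have := iterY m.+1 1 m.+1.
    rewrite -actY y0 (mod_act0 lowest_weight_module) coef0 ltnn subnn coef1.
    by rewrite iter_rmorph1 => /esym/eqP; rewrite oner_eq0.
  - move=> p j le_jm; exists 0; rewrite actY iterY ltnS le_jm iter_rmorph0.
    by rewrite mulr0.
have [e] := NX m (leqnn m); rewrite subnn coefXn eqxx => E1.
have be1 : beta m.+1 * e = 1 by rewrite -E1.
have mue1 : mu e * beta m.+1 = 1 by rewrite -beta_comm.
(* e and mu e are one-sided inverses on opposite sides *)
have mu_e : mu e = e by rewrite -[LHS]mulr1 -be1 mulrA mue1 mul1r.
by apply/unitrP; exists e; rewrite -{1}mu_e.
Qed.

Lemma coef_b1 : coef_b sigma b rho 1 = b.
Proof. by rewrite /coef_b big_geq //= add0r. Qed.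

Lemma b_unit : b \is a GRing.unit.
Proof. by have := beta_unit 0; rewrite /= rmorph0 mulr0 add0r. Qed.

(** The two recursions agree because [mu], being conjugation by the unit [b],
    fixes every [beta j]. *)
Lemma coef_b_beta j : coef_b sigma b rho j.+1 = iter j sigma (beta j.+1).
Proof.
have mu_beta k : mu (beta k) = beta k.
  have mub : mu b = b.
    by apply: (mulIr b_unit); rewrite -[LHS]/(sigma (tau b) * b) bP.
  apply: (mulIr b_unit).
  by rewrite -[LHS]/(sigma (tau _) * b) bP beta_comm mub.
elim: j => [|j IH]; first by rewrite coef_b1 /= rmorph0 mulr0 add0r.
rewrite coef_bS // IH [beta j.+2]/(rho * tau (beta j.+1) + b).
rewrite [RHS]iter_rmorphD; congr (_ + _).
rewrite [RHS]iter_rmorphM; congr (_ * _).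
by rewrite [RHS]iterSr -[sigma _]/(mu _) mu_beta.
Qed.

Lemma coef_b_unit i : (0 < i)%N -> coef_b sigma b rho i \is a GRing.unit.
Proof. by case: i => // i _; rewrite coef_b_beta unitr_iter ?beta_unit. Qed.

(** The elements that some power of [sigma] sends into [I] form an ideal [K]
    stable under [sigma], and under [tau] as [sigma (tau e)] is a conjugate of
    [e]. If [K] is all of [D], then 1 lies in [I]. *)
Lemma sigma_simple : endo_simple sigma.
Proof.
move=> I idI Is; have [I0 ID IM] := idI.
have Iit m d : I d -> I (iter m sigma d).
  by move=> Id; elim: m => //= m; apply: Is.
pose K d := exists n, I (iter n sigma d).
have idK : two_sided_ideal K.
  split; first by exists 0%N.
    move=> d1 d2 [m I1] [n I2]; exists (m + n)%N.
    rewrite iter_rmorphD; apply: ID.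
      by rewrite addnC iterD; apply: Iit.
    by rewrite iterD; apply: Iit.
  move=> a e [n En]; split; exists n; rewrite iter_rmorphM.
    exact: (IM _ _ En).1.
  exact: (IM _ _ En).2.
have Ks e : K e -> K (sigma e).
  by case=> n In; exists n; rewrite -iterSr; apply: Is.
have Kt e : K e -> K (tau e).
  case=> n In; exists n.+1; rewrite iterSr.
  have -> : sigma (tau e) = b * e * b^-1 by rewrite -bP mulrK // b_unit.
  by rewrite !iter_rmorphM; apply: (IM _ _ _).2; apply: (IM _ _ _).1.
case: (stable_ideal_trivial idK Ks Kt) => [K0|Kfull].
  left=> d; split=> [Id|-> //]; by apply/K0; exists 0%N.
have [n] := Kfull 1; rewrite iter_rmorph1 => I1.
by right=> d; rewrite -[d]mulr1; apply: (IM _ _ I1).1.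
Qed.


End SimpleImplies.

(** * The criterion on the side of sigma *)

Lemma inj_surj_bij (T : choiceType) (f : T -> T) :
  injective f -> (forall d, exists c, f c = d) -> bijective f.
Proof.
move=> inj_f surj_f; have ex d : exists c, f c == d.
  by have [c <-] := surj_f d; exists c.
exists (fun d => xchoose (ex d)) => d; last exact/eqP/(xchooseP (ex d)).
by apply: inj_f; apply/eqP/(xchooseP (ex (f d))).
Qed.

Lemma bij_unit (R : unitRingType) (f : {rmorphism R -> R}) x :
  bijective f -> f x \is a GRing.unit -> x \is a GRing.unit.
Proof.
move=> [g fK gK] fxU; apply/unitrP; exists (g (f x)^-1).
by split; apply: (can_inj fK); rewrite rmorphM gK rmorph1 (mulVr, mulrV).
Qed.

Section Criterion.
Variables (D : unitRingType) (sigma tau : {rmorphism D -> D}) (b rho : D).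
Local Notation nu := (nu_endo sigma tau).
Local Notation E := (diskew sigma tau b rho).
Hypothesis rhoP : forall d, sigma (tau d) * rho = rho * tau (sigma d).
Hypothesis bP : forall d, sigma (tau d) * b = b * d.
Hypothesis rhoU : rho \is a GRing.unit.
Hypothesis nu_surj : forall d, exists c, nu c = d.

Definition simplicity_criterion :=
  [/\ bijective sigma /\ bijective tau,
      endo_simple sigma,
      (forall n, (0 < n)%N ->
         ~ exists (d_ : 'I_n -> D) p, @normal_poly _ sigma tau b rho n d_ p) &
      (forall i, (0 < i)%N -> coef_b sigma b rho i \is a GRing.unit)].

Lemma criterion_b_unit : simplicity_criterion -> b \is a GRing.unit.
Proof. by case=> _ _ _ /(_ 1%N isT); rewrite coef_b1. Qed.

Lemma simple_iff_criterion : simple_ring E <-> simplicity_criterion.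
Proof.
split=> [simpleE|crit].
  have surj_s := sigma_surj rhoP rhoU nu_surj.
  split.
  - split; apply: inj_surj_bij => //.
    + exact: sigma_inj rhoP bP rhoU simpleE.
    + exact: tau_inj rhoP bP rhoU simpleE.
    + exact: tau_surj nu_surj.
  - exact: sigma_simple rhoP bP rhoU simpleE nu_surj.
  - exact: no_normal_poly rhoP bP rhoU simpleE.
  - exact: coef_b_unit rhoP bP rhoU simpleE nu_surj.
have bU := criterion_b_unit crit.
have [[[sigma' sK s'K] _] simple_s no_p b_units] := crit.
have inj_s := can_inj sK.
(* applying sigma to nu d * u = u * d gives bP at sigma d *)
apply: (diskew_simple rhoP bP rhoU (u := sigma' b)) => //.
- by apply: (bij_unit (f := sigma)); [exists sigma' | rewrite s'K].
- by move=> d; apply: inj_s; rewrite !rmorphM /= s'K bP.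
- by move=> d; exists (sigma' d).
Qed.

End Criterion.

(** * Exchanging the generators x and y *)

Lemma simple_ring_onto (R T : pzRingType) (f : {rmorphism R -> T}) :
  (1 : T) <> 0 -> (forall t, exists r, f r = t) ->
  simple_ring R -> simple_ring T.
Proof.
move=> T_nz f_surj [_ simpleR]; split=> // I [I0 ID IM].
have idJ : two_sided_ideal (fun r => I (f r)).
  split; first by rewrite rmorph0.
    by move=> r s Ir Is; rewrite rmorphD; apply: ID.
  by move=> a r Ir; rewrite !rmorphM; apply: IM.
case: (simpleR _ idJ) => [J0|Jfull]; last by right=> t; have [r <-] := f_surj t.
left=> t; split=> [|-> //]; have [r <-] := f_surj t.
by move=> /J0 ->; rewrite rmorph0.
Qed.

Section UniversalProperty.
Variables (D : nzRingType) (sigma tau : D -> D) (b rho : D).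
Variables (T : pzRingType) (f : {rmorphism D -> T}) (X Y : T).
Local Notation E := (diskew sigma tau b rho).
Hypotheses (Xf : forall d, X * f d = f (sigma d) * X)
  (Yf : forall d, Y * f d = f (tau d) * Y) (XY : X * Y - f rho * Y * X = f b).

Lemma left_mult_module : diskew_module sigma tau b rho
  (fun d (t : T) => f d * t) ( *%R X) ( *%R Y).
Proof.
split=> *; rewrite ?mulrDr ?rmorphD ?mulrDl ?rmorphM ?mulrA ?rmorph1 ?mul1r //.
- by rewrite Xf.
- by rewrite Yf.
- by rewrite -mulrBl XY.
Qed.

(** The universal property of E, obtained by letting E act on [T] through left
    multiplications and evaluating at 1. *)
Lemma diskew_lift : exists F : {rmorphism E -> T},
  [/\ forall d, F (diskewC sigma tau b rho d) = f d,
      F (diskewX sigma tau b rho) = X & F (diskewY sigma tau b rho) = Y].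
Proof.
have mT := left_mult_module.
pose act : E -> T -> T := mod_act (fun d (t : T) => f d * t) ( *%R X) ( *%R Y).
have act1 e t : act e t = act e 1 * t.
  move: e t; apply: diskew_lmul_ind.
  - by move=> e e' IH IH' t; rewrite /act !(mod_actDl mT) mulrDl -IH -IH'.
  - move=> d e IH t; rewrite /act !(mod_actM mT) !(mod_actC mT) -mulrA.
    by congr (_ * _); apply: IH.
  - move=> e IH t; rewrite /act !(mod_actM mT) !(mod_actX mT) -mulrA.
    by congr (_ * _); apply: IH.
  - move=> e IH t; rewrite /act !(mod_actM mT) !(mod_actY mT) -mulrA.
    by congr (_ * _); apply: IH.
  - by move=> t; rewrite /act !(mod_act1 mT) mul1r.
pose F e := act e 1.
have FB : zmod_morphism F.
  by move=> e e'; apply: (addIr (F e')); rewrite -(mod_actDl mT) !subrK.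
have FM : monoid_morphism F.
  split=> [|e e']; first exact: mod_act1 mT _.
  by rewrite /F {1}/act (mod_actM mT); apply: act1.
pose FR : {rmorphism E -> T} := HB.pack F
  (GRing.isZmodMorphism.Build _ _ _ FB) (GRing.isMonoidMorphism.Build _ _ _ FM).
exists FR; split=> [d||].
- exact: etrans (mod_actC mT _ _) (mulr1 _).
- exact: etrans (mod_actX mT _) (mulr1 _).
- exact: etrans (mod_actY mT _) (mulr1 _).
Qed.

End UniversalProperty.

(** The relation on [y * x] is what a morphism from E to E' exchanging the
    generators has to respect; such a morphism is onto. *)
Lemma swap_simple (D : nzRingType) (sigma tau : D -> D) (b rho b' rho' : D) :
  let E := diskew sigma tau b rho in
  let E' := diskew tau sigma b' rho' in
  let c := diskewC tau sigma b' rho' in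
  let x := diskewX tau sigma b' rho' in
  let y := diskewY tau sigma b' rho' in
  (1 : E') <> 0 -> y * x - c rho * x * y = c b ->
  simple_ring E -> simple_ring E'.
Proof.
move=> E E' c x y nz yx.
have [F [FC FX FY]] : exists F : {rmorphism E -> E'},
  [/\ forall d, F (diskewC sigma tau b rho d) = c d,
      F (diskewX sigma tau b rho) = y & F (diskewY sigma tau b rho) = x].
  by apply: diskew_lift yx => d; rewrite ?diskewXC ?diskewYC.
apply: simple_ring_onto (F) nz _; apply: diskew_lmul_ind.
- by move=> _ _ [e <-] [e' <-]; exists (e + e'); rewrite rmorphD.
- move=> d _ [e <-]; exists (diskewC sigma tau b rho d * e).
  by rewrite rmorphM FC.
- by move=> _ [e <-]; exists (diskewY sigma tau b rho * e); rewrite rmorphM FY.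
- by move=> _ [e <-]; exists (diskewX sigma tau b rho * e); rewrite rmorphM FX.
- by exists 1; rewrite rmorph1.
Qed.

(** Multiply the given relation by [- f r^-1] on the left. *)
Lemma swap_relation (D : unitRingType) (T : pzRingType) (f : {rmorphism D -> T})
    (r z : D) (X Y : T) : r \is a GRing.unit ->
  X * Y - f r * Y * X = f z -> Y * X - f r^-1 * X * Y = f (- (r^-1 * z)).
Proof.
move=> rU XY; rewrite rmorphN rmorphM -XY mulrBr opprB !mulrA -rmorphM.
by rewrite mulVr // rmorph1 mul1r.
Qed.

Section Swap.
Variables (D : unitRingType) (sigma tau : {rmorphism D -> D}) (b rho : D).
Local Notation nu := (nu_endo sigma tau).
Local Notation mu := (mu_endo sigma tau).
Local Notation C := (hC sigma tau).
Local Notation h := (hX sigma tau).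
Local Notation h' := (hX' sigma tau b rho).
Local Notation tauD := (tau_ext sigma tau b rho).
Local Notation E := (diskew sigma tau b rho).
Hypothesis rhoP : forall d, sigma (tau d) * rho = rho * tau (sigma d).
Hypothesis bP : forall d, sigma (tau d) * b = b * d.
Hypothesis rhoU : rho \is a GRing.unit.

Definition swap_b := - (rho^-1 * b).
Local Notation E' := (diskew tau sigma swap_b rho^-1).

Lemma swap_rhoP d : tau (sigma d) * rho^-1 = rho^-1 * sigma (tau d).
Proof. by apply: (mulrI rhoU); rewrite mulVKr // mulrA -rhoP mulrK. Qed.

Lemma swap_bP d : tau (sigma d) * swap_b = swap_b * d.
Proof. by rewrite mulrN mulNr mulrA swap_rhoP -mulrA bP mulrA. Qed.

Lemma swap_rhoU : rho^-1 \is a GRing.unit.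
Proof. by rewrite unitrV. Qed.

Lemma simple_swap : simple_ring E <-> simple_ring E'.
Proof.
have nzE := diskew_neq0 rhoP bP rhoU.
have nzE' := diskew_neq0 swap_rhoP swap_bP swap_rhoU.
split; apply: swap_simple => //; last exact: swap_relation (diskewXY _ _ _ _).
have swapK : - (rho * swap_b) = b by rewrite mulrN opprK mulVKr.
by have := swap_relation swap_rhoU (diskewXY tau sigma swap_b rho^-1);
  rewrite invrK swapK.
Qed.

(** With the generators exchanged, the product of [y] and [x] that plays the
    role of [h] is [x y = h']. *)
Definition unswap : hring tau sigma -> hring sigma tau :=
  skew_eval (skewC nu \o idfun) h'.

Local Notation Cid := (skewC nu \o idfun).

Lemma unswap_twist d : h' * Cid d = Cid (mu d) * h'.
Proof. exact: hX'C. Qed.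

Definition unswap_rm : {rmorphism hring tau sigma -> hring sigma tau} :=
  HB.pack unswap
    (GRing.isZmodMorphism.Build _ _ _
      (@skew_eval_is_zmod_morphism _ mu _ Cid h'))
    (GRing.isMonoidMorphism.Build _ _ _
      (@skew_eval_is_monoid_morphism _ mu _ Cid h' unswap_twist)).

Lemma unswapC d : unswap_rm (hC tau sigma d) = C d.
Proof. exact: (@skew_evalC _ mu _ Cid h'). Qed.

Lemma unswapX : unswap_rm (hX tau sigma) = h'.
Proof. exact: (@skew_evalX _ mu _ Cid h'). Qed.

Lemma unswap_inj : injective unswap_rm.
Proof.
apply: rmorph_inj0 => p; apply: (@skew_eval_eq0 _ _ _ idfun) => //.
  exact: ssize_hX'.
by rewrite coefs_hX'1.
Qed.

Lemma unswap_sigma p :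
  unswap_rm (sigma_ext tau sigma swap_b rho^-1 p) = tauD (unswap_rm p).
Proof.
elim/skewpoly_ind: p => [p q Ep Eq|p q Ep Eq|d|].
- by rewrite sigma_extD !rmorphD Ep Eq tau_extD.
- by rewrite (sigma_extM swap_rhoP swap_bP) !rmorphM Ep Eq tau_extM.
- by rewrite -[skewC _ d]/(hC tau sigma d) sigma_extC !unswapC tau_extC.
- rewrite -[skewX _]/(hX tau sigma) sigma_extX /hX' rmorphD rmorphM !unswapC.
  rewrite unswapX.
  rewrite /hX' tau_extD tau_extM // !tau_extC tau_extX mulrA -!rmorphM mulrV //.
  rewrite !rmorph1 mul1r subrK mulrDr mulrA -!rmorphM mulVr // rmorph1 mul1r.
  by rewrite /swap_b rmorphN addrK.
Qed.

Definition normal_poly' n (d_ : 'I_n -> D) (p : hring sigma tau) :=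
  [/\ p = h' ^+ n + \sum_(i < n) C (d_ i) * h' ^+ i,
      (forall d : D, p * C d = C (iter n mu d) * p),
      tauD p = C (\prod_(i < n) iter i mu rho^-1) * p &
      h' * p - p * h' = 0].

Lemma normal_poly_swap n (d_ : 'I_n -> D) :
  (exists p, @normal_poly D tau sigma swap_b rho^-1 n d_ p) <->
  (exists p, normal_poly' d_ p).
Proof.
pose q := hX tau sigma ^+ n +
  \sum_(i < n) hC tau sigma (d_ i) * hX tau sigma ^+ i.
have qE : unswap_rm q = h' ^+ n + \sum_(i < n) C (d_ i) * h' ^+ i.
  rewrite rmorphD rmorphXn unswapX rmorph_sum; congr (_ + _).
  by apply: eq_bigr => i _; rewrite rmorphM rmorphXn unswapX unswapC.
split=> [[p [-> pC sp hp]]|[p [pE pC tp hp]]].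
  exists (unswap_rm q); split=> // [d||].
  - by rewrite -unswapC -!rmorphM pC rmorphM unswapC.
  - by rewrite -unswap_sigma sp rmorphM unswapC.
  - by rewrite -unswapX -!rmorphM -rmorphB hp rmorph0.
exists q; rewrite -qE in pE; rewrite pE in pC tp hp.
split=> // [d||]; apply: unswap_inj.
- by rewrite !rmorphM !unswapC pC.
- by rewrite unswap_sigma tp rmorphM unswapC.
- by rewrite rmorphB !rmorphM unswapX hp rmorph0.
Qed.

(** With the generators exchanged, [h'] plays the role of [h], and
    [h = tau(h')]; so [tau^i(h)] is [tau] applied to [tau^i(h')]. *)
Lemma coef_b'_swap i : (0 < i)%N ->
  coef_b' tau b rho i = tau (coef_b tau swap_b rho^-1 i).
Proof.
case: i => // i _; elim: i => [|i IH].
  by rewrite coef_b1 /coef_b' big_geq // oppr0 add0r /swap_b rmorphN.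
rewrite [in RHS]coef_bS // coef_b'S // IH [RHS]rmorphD; congr (_ + _).
  by rewrite [RHS]rmorphM.
by rewrite /swap_b iter_rmorphN rmorphN.
Qed.

Definition simplicity_criterion' :=
  [/\ bijective sigma /\ bijective tau,
      endo_simple tau,
      (forall n, (0 < n)%N ->
         ~ exists (d_ : 'I_n -> D) p, normal_poly' d_ p) &
      (forall i, (0 < i)%N -> coef_b' tau b rho i \is a GRing.unit)].

Lemma criterion_swap :
  simplicity_criterion tau sigma swap_b rho^-1 <-> simplicity_criterion'.
Proof.
split=> -[[bij1 bij2] simple_t no_p bU]; split=> // [n n_gt0|i i_gt0].
- by case=> d_ /normal_poly_swap ex_p; apply: (no_p n n_gt0); exists d_.
- by rewrite coef_b'_swap // rmorph_unit ?bU.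
- by case=> d_ /normal_poly_swap ex_p; apply: (no_p n n_gt0); exists d_.
- by apply: (bij_unit bij2); rewrite -coef_b'_swap ?bU.
Qed.

Lemma criterion'_b_unit : simplicity_criterion' -> b \is a GRing.unit.
Proof.
move/criterion_swap/criterion_b_unit; rewrite /swap_b unitrN.
by rewrite unitrMr ?unitrV.
Qed.

End Swap.

Theorem theorem1p3 (D : unitRingType) (sigma tau : {rmorphism D -> D})
    (b rho : D)
    (rhoP : forall d : D, sigma (tau d) * rho = rho * tau (sigma d))
    (bP : forall d : D, sigma (tau d) * b = b * d)
    (rhoU : rho \is a GRing.unit)
    (nu_surj : forall d : D, exists c : D, nu_endo sigma tau c = d) :
  let E := diskew sigma tau b rho in
  let calD := hring sigma tau in
  let nu := nu_endo sigma tau in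
  let mu := mu_endo sigma tau in
  let C := hC sigma tau in
  let h := hX sigma tau in
  let h' := hX' sigma tau b rho in
  let sigma_calD := sigma_ext sigma tau b rho in
  let tau_calD := tau_ext sigma tau b rho in
  let cond1 := simple_ring E in
  let cond2 :=
    [/\ bijective sigma /\ bijective tau,
        endo_simple sigma,
        (forall n : nat, (0 < n)%N ->
           ~ exists (d_ : 'I_n -> D) (p : calD),
               [/\ p = h ^+ n + \sum_(i < n) C (d_ i) * h ^+ i,
                   (forall d : D, p * C d = C (iter n nu d) * p),
                   sigma_calD p = C (\prod_(i < n) iter i nu rho) * p &
                   h * p - p * h = 0]) &
        (forall i : nat, (0 < i)%N ->
           coef_b sigma b rho i \is a GRing.unit)] in
  let cond3 :=
    [/\ bijective sigma /\ bijective tau,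
        endo_simple tau,
        (forall n : nat, (0 < n)%N ->
           ~ exists (d_ : 'I_n -> D) (p' : calD),
               [/\ p' = h' ^+ n + \sum_(i < n) C (d_ i) * h' ^+ i,
                   (forall d : D, p' * C d = C (iter n mu d) * p'),
                   tau_calD p' = C (\prod_(i < n) iter i mu rho^-1) * p' &
                   h' * p' - p' * h' = 0]) &
        (forall i : nat, (0 < i)%N ->
           coef_b' tau b rho i \is a GRing.unit)] in
  [/\ cond1 <-> cond2, cond1 <-> cond3,
      (cond2 -> b \is a GRing.unit) & (cond3 -> b \is a GRing.unit)].
Proof.
move=> E calD nu mu C h h' sigma_calD tau_calD cond1 cond2 cond3; split.
- exact: simple_iff_criterion.
- have mu_onto := mu_surj rhoP rhoU nu_surj.
  have crit := simple_iff_criterion (swap_rhoP rhoP rhoU) (swap_bP rhoP bP rhoU)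
    (swap_rhoU rhoU) mu_onto.
  exact: iff_trans (simple_swap rhoP bP rhoU)
    (iff_trans crit (criterion_swap rhoP bP rhoU)).
- exact: criterion_b_unit.
- exact: (criterion'_b_unit rhoP bP rhoU).
Qed.
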